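(* Let $\mathscr H$ be a complex Hilbert space, let $m,M$ be positive real numbers with $m<1<M$, and let $A_j,B_j\in\mathbb B(\mathscr H)$ $(1\le j\le n)$ satisfy $0<mA_j\le B_j\le MA_j$ for $1\le j\le n$ and $$0<m\Big(I_{\mathscr H}-\sum_{j=1}^nA_j\Big)\le I_{\mathscr H}-\sum_{j=1}^nB_j\le M\Big(I_{\mathscr H}-\sum_{j=1}^nA_j\Big).$$ Let $\sigma_f$ be an operator mean with representing function $f$, let $p\in[0,1]$, and put $$\mu_f=\frac{f(M)-f(m)}{M-m},\qquad\nu_f=\frac{Mf(m)-mf(M)}{M-m},\qquad\beta_f=\max_{m\le t\le M}\{f(t)-\mu_ft-\nu_f\}.$$ Then $$\left(\beta_fI_{\mathscr H}+\Big(I_{\mathscr H}-\sum_{j=1}^nA_j\Big)\sigma_f\Big(I_{\mathscr H}-\sum_{j=1}^nB_j\Big)\right)^p\ge\left(I_{\mathscr H}-\sum_{j=1}^n(A_j\sigma_fB_j)\right)^p.$$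
   Context: $\mathbb B(\mathscr H)$ is the algebra of bounded linear operators on $\mathscr H$, with identity $I_{\mathscr H}$. $A\ge0$ means $\langle Ax,x\rangle\ge0$ for all $x$; $A>0$ means $A\ge0$ and $A$ is invertible; $A\le B$ means $B-A\ge0$ for self-adjoint $A,B$. An operator mean (in the sense of Kubo and Ando) with representing function $f$ is the operation $A\sigma_fB=A^{1/2}f(A^{-1/2}BA^{-1/2})A^{1/2}$ on positive invertible operators, where $f:(0,\infty)\to(0,\infty)$ is operator monotone ($A\le B$ implies $f(A)\le f(B)$) and $f(1)=1$. Powers of positive operators are defined by functional calculus, with $X^0=I_{\mathscr H}$. *)

(* Defs.v *)
From HB Require Import structures.
From mathcomp Require Import all_boot all_order all_algebra.
From mathcomp Require Import sesquilinear complex.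
From mathcomp Require Import all_classical all_reals all_analysis.

Set Implicit Arguments.
Unset Strict Implicit.
Unset Printing Implicit Defensive.

Import Order.TTheory GRing.Theory Num.Theory.
Import numFieldNormedType.Exports.

Local Open Scope classical_set_scope.
Local Open Scope complex_scope.
Local Open Scope ring_scope.

(* A complex Hilbert space is a complete normed R[i]-module whose norm comes   *)
(* from an inner product; [inner] is linear in its first argument and          *)
(* conjugate-linear in its second one.                                         *)
HB.mixin Record NormedModule_isHilbert (R : realType) V
    & CompleteNormedModule R[i] V := {
  inner : {dot V for @Num.conj R[i]} ;
  inner_norm : forall x : V, inner x x = `|x| ^+ 2
}.

#[short(type="hilbertType")]
HB.structure Definition Hilbert (R : realType) :=
  {V of CompleteNormedModule R[i] V & NormedModule_isHilbert R V}.

Section BoundedOperators.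
Context {K : numFieldType} {V : normedModType K}.
Implicit Types f g : V -> V.

Definition bounded_operator_subdef f :=
  linear f /\ exists k : K, forall x, `|f x| <= k * `|x|.

Definition bounded_operator : {pred V -> V} :=
  fun f => `[< bounded_operator_subdef f >].

Lemma bounded_operatorP f :
  reflect (bounded_operator_subdef f) (f \in bounded_operator).
Proof. exact: asboolP. Qed.

Lemma bounded_operator_ge0 f : bounded_operator_subdef f ->
  exists2 k : K, 0 <= k & forall x, `|f x| <= k * `|x|.
Proof.
move=> [lf [k fk]]; have [[x x0]|nx] := pselect (exists x : V, x != 0).
  exists k => //; rewrite -(@pmulr_lge0 _ `|x|) ?normr_gt0//.
  exact: le_trans (fk x).
exists 0 => // x; have -> : x = 0.
  by apply/eqP; apply: contra_notT nx => x0; exists x.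
have -> : f 0 = 0.
  by have := lf (-1) 0 0; rewrite !scaleN1r !addNr.
by rewrite normr0 mulr0.
Qed.

Lemma bounded_operator_submod : submod_closed bounded_operator.
Proof.
split; first (apply/bounded_operatorP; split).
- by move=> a x y; rewrite -[LHS](addr0 0) -[X in X + _](scaler0 _ a).
- by exists 0 => x; rewrite normr0 mul0r.
move=> a f g /bounded_operatorP[lf [kf fk]] /bounded_operatorP[lg [kg gk]].
apply/bounded_operatorP; split.
- move=> b x y; rewrite !fctE lf lg !scalerDr !scalerA (mulrC a b).
  by rewrite addrACA.
- exists (`|a| * kf + kg) => x; rewrite !fctE.
  rewrite (le_trans (ler_normD _ _))// normrZ mulrDl -mulrA.
  by rewrite lerD// ler_wpM2l.
Qed.

HB.instance Definition _ :=
  GRing.isSubmodClosed.Build K (V -> V) bounded_operator bounded_operator_submod.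

Lemma bounded_operator_id : id \in bounded_operator.
Proof. by apply/bounded_operatorP; split=> //; exists 1 => x; rewrite mul1r. Qed.

Lemma bounded_operator_comp f g :
  f \in bounded_operator -> g \in bounded_operator ->
  f \o g \in bounded_operator.
Proof.
move=> /bounded_operatorP bf /bounded_operatorP[lg [kg gk]].
have [kf kf0 fk] := bounded_operator_ge0 bf.
apply/bounded_operatorP; split=> [a x y|]; first by rewrite /= lg bf.1.
exists (kf * kg) => x /=; rewrite (le_trans (fk _))// -mulrA.
exact: ler_wpM2l.
Qed.

End BoundedOperators.

(* The algebra 'B(V) of bounded operators; its product is composition.         *)
Record bop (K : numFieldType) (V : normedModType K) :=
  Bop { bop_val :> V -> V ; bop_subproof : bop_val \in bounded_operator }.

Reserved Notation "''B' ( V )" (at level 8, format "''B' ( V )").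
Notation "''B' ( V )" := (bop V) : type_scope.

Section BopAlgebra.
Context {K : numFieldType} {V : normedModType K}.
Implicit Types A B : 'B(V).

HB.instance Definition _ := [isSub of 'B(V) for @bop_val K V].
HB.instance Definition _ := [Choice of 'B(V) by <:].
HB.instance Definition _ := [SubChoice_isSubLmodule of 'B(V) by <:].

Definition bop_one : 'B(V) := Bop bounded_operator_id.
Definition bop_mul A B : 'B(V) :=
  Bop (bounded_operator_comp (bop_subproof A) (bop_subproof B)).

Lemma bop_linear A : linear A.
Proof. by have /bounded_operatorP[] := bop_subproof A. Qed.

Lemma bop_ext A B : (forall x, A x = B x) -> A = B.
Proof. by move=> AB; apply/val_inj/funext. Qed.

Lemma bop_mulA : associative bop_mul.
Proof. by move=> A B C; exact: bop_ext. Qed.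
Lemma bop_mul1 : left_id bop_one bop_mul.
Proof. by move=> A; exact: bop_ext. Qed.
Lemma bop_mulr1 : right_id bop_one bop_mul.
Proof. by move=> A; exact: bop_ext. Qed.
Lemma bop_mulDl : left_distributive bop_mul +%R.
Proof. by move=> A B C; exact: bop_ext. Qed.
Lemma bop_mulDr : right_distributive bop_mul +%R.
Proof.
move=> A B C; apply: bop_ext => x.
by have := bop_linear A 1 (B x) (C x); rewrite !scale1r.
Qed.

HB.instance Definition _ := GRing.Zmodule_isPzRing.Build 'B(V)
  bop_mulA bop_mul1 bop_mulr1 bop_mulDl bop_mulDr.

End BopAlgebra.

Section Operators.
Context {R : realType} {H : hilbertType R}.
Implicit Types (A B : 'B(H)) (f : R -> R) (p : R).

Definition opunit A := exists B, A * B = 1 /\ B * A = 1.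

(* The order of R[i] makes [0 <= z] say that z is real and nonnegative. As the *)
(* scalars are complex, [opge0 A] implies that A is self-adjoint.              *)
Definition opge0 A := forall x : H, 0 <= inner (A x) x.
Definition opgt0 A := opge0 A /\ opunit A.
Definition ople A B := opge0 (B - A).

Definition spectrum A : set R[i] := [set z | ~ opunit (A - z *: (1 : 'B(H)))].

(* The evaluation of the poly library requires a nontrivial ring, which 'B(H)  *)
(* is not when H is the zero space.                                            *)
Definition opoly (q : {poly R}) A : 'B(H) :=
  \sum_(i < size q) (q`_i)%:C *: A ^+ i.

(* Continuous functional calculus of a self-adjoint A: f(A) is the limit, in   *)
(* operator norm, of q(A) for real polynomials q which tend to f uniformly on  *)
(* the (real) spectrum of A.                                                   *)
Definition is_cfc f A B := forall e : R, 0 < e -> exists q : {poly R},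
  (forall t : R, spectrum A t%:C -> `|q.[t] - f t| <= e) /\
  (forall x : H, `|opoly q A x - B x| <= e%:C * `|x|).

Definition cfc f A : 'B(H) := xget 0 [set B | is_cfc f A B].

(* [t `^ 0 = 1] for all t, so that [oppow A 0] is the identity.                *)
Definition oppow A p : 'B(H) := cfc (fun t => t `^ p) A.

Definition opmean f A B : 'B(H) :=
  let S := oppow A (2^-1) in let T := oppow A (- 2^-1) in
  S * cfc f (T * B * T) * S.

End Operators.

(* As usual, the order relation is required on every Hilbert space: on a space *)
(* of dimension one it would only say that f is nondecreasing.                 *)
Definition operator_monotone (R : realType) (f : R -> R) :=
  forall (K : hilbertType R) (A B : 'B(K)),
    opgt0 A -> opgt0 B -> ople A B -> ople (cfc f A) (cfc f B).

(* Continuity belongs to the notion of operator monotone function, which is    *)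
(* defined by the continuous functional calculus. The values of f outside      *)
(* ]0, +oo[ play no role.                                                      *)
Definition representing_function (R : realType) (f : R -> R) :=
  [/\ forall t, 0 < t -> 0 < f t,
      {in `]0, +oo[, continuous f},
      operator_monotone f & f 1 = 1].

Section Chord.
Context {R : realType}.
Implicit Types (f : R -> R) (m M : R).

Definition chord_slope f m M := (f M - f m) / (M - m).
Definition chord_const f m M := (M * f m - m * f M) / (M - m).
(* The supremum is a maximum by [chord_gap_max].                               *)
Definition chord_gap f m M : R :=
  sup [set f t - chord_slope f m M * t - chord_const f m M | t in `[m, M]].

Lemma chord_gap_max f m M : representing_function f -> 0 < m -> m < M ->
  let gap t := f t - chord_slope f m M * t - chord_const f m M in
  exists2 t, t \in `[m, M] &
    chord_gap f m M = gap t /\ {in `[m, M], forall s, gap s <= gap t}.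
Proof.
move=> [_ fc _ _] m0 mM gap.
have gapc : {within `[m, M], continuous gap}.
  apply: continuous_in_subspaceT => t; rewrite inE/= in_itv/= => /andP[mt _].
  have ft : {for t, continuous f}.
    by apply: fc; rewrite in_itv/= (lt_le_trans m0).
  apply: cvgB; last exact: cvg_cst.
  apply: cvgB => //; apply: cvgM; [exact: cvg_cst | exact: cvg_id].
have [t tmM tmax] := EVT_max (ltW mM) gapc.
exists t => //; split=> //; apply/eqP; rewrite eq_le; apply/andP; split.
  apply: ge_sup; first by exists (gap t); exists t.
  by move=> _ [s smM <-]; exact: tmax.
apply: ub_le_sup; last by exists t.
by exists (gap t) => _ [s smM <-]; exact: tmax.
Qed.

End Chord.

(* Main.v *)
(* Scalar functions: f is concave, so on [m, M] it lies above the chord         *)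
(* [mu_f t + nu_f] and below a supporting line [1 - s + s t] at t = 1. Put      *)
(* A_0 = I - sum A_j and B_0 = I - sum B_j. Inserting these two affine bounds   *)
(* in the functional calculus of A_j^(-1/2) B_j A_j^(-1/2) gives                *)
(*   [nu_f A_j + mu_f B_j <= A_j sigma_f B_j <= (1 - s) A_j + s B_j].           *)
(* Summing the lower bounds over j = 0, ..., n gives at least (mu_f + nu_f) I,  *)
(* hence at least (1 - beta_f) I, which is the claim for p = 1. Summing the     *)
(* upper bounds over j >= 1 gives I - sum A_j sigma_f B_j >= A_0 sigma_f B_0,   *)
(* so that both sides are positive and invertible, and the Loewner-Heinz        *)
(* inequality applies.                                                          *)
Require Import Defs.
From HB Require Import structures.
From mathcomp Require Import all_boot all_order all_algebra.
From mathcomp Require Import sesquilinear complex ring lra.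
From mathcomp Require Import all_classical all_reals all_analysis.

Set Implicit Arguments.
Unset Strict Implicit.
Unset Printing Implicit Defensive.

Import Order.TTheory GRing.Theory Num.Theory.
Import numFieldNormedType.Exports.

Local Open Scope classical_set_scope.
Local Open Scope complex_scope.
Local Open Scope ring_scope.

(** * Weierstrass approximation *)

(** Two facts carry the theorem: an operator monotone function on the half-line is concave, and the
    power p in [0, 1] preserves the operator order ([loewner_heinz]). Concavity
    ([operator_monotone_concave]) is tested on 2 by 2 matrices, and yields an affine minorant of f
    on [m, M] ([chord_le]) and an affine majorant touching f at 1 ([supergradient]). By [opmean_le]
    an affine bound k + l t for f on [m, M] becomes the bound k A + l B for the mean of A and B.
    Such bounds are additive in the pair (A, B), and the n + 1 pairs, including the complementary
    one, add up to (I, I). Hence the sum of all means is at least (mu_f + nu_f) I and at most I.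
    Since f(1) = 1, beta_f is at least 1 - mu_f - nu_f, which gives the inequality for p = 1. By the
    upper bound, I minus the sum of the means dominates the complementary mean, and so a positive
    multiple of I minus the sum of the A_j; this makes both sides invertible, as [loewner_heinz]
    requires. The functional calculus behind this rests on [selfadj_norm_le]: a self-adjoint
    operator is bounded in norm by any bound of its real spectrum. With spectral mapping
    ([spectrum_opoly]) this controls q(A) by the values of q on the spectrum of A, and [weierstrass]
    extends the calculus to continuous functions ([cfc_ex]). Operator inequalities are handled as
    inequalities between real quadratic forms. *)

Section Weierstrass.
Context {R : realType}.
Implicit Types (f : R -> R) (g h : nat -> R) (a b c e x y : R) (n : nat).

(* [(bernstein n g).[x]] is the expectation of g under the binomial law of     *)
(* parameters n and x; conditioning on the last trial gives the recursion.     *)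
Fixpoint bernstein n g : {poly R} :=
  if n is n'.+1 then
    'X * bernstein n' (fun k => g k.+1) + (1 - 'X) * bernstein n' g
  else (g 0)%:P.

Lemma bernsteinS n g x : (bernstein n.+1 g).[x] =
  x * (bernstein n (fun k => g k.+1)).[x] + (1 - x) * (bernstein n g).[x].
Proof. by rewrite /= !hornerE. Qed.

Lemma le_bernstein n g h x : 0 <= x <= 1 -> (forall k, (k <= n)%N -> g k <= h k) ->
  (bernstein n g).[x] <= (bernstein n h).[x].
Proof.
move=> /andP[x0 x1]; elim: n g h => [|n IH] g h gh; first by rewrite !hornerE gh.
rewrite !bernsteinS lerD// ler_wpM2l ?subr_ge0//; apply: IH => k kn.
  exact: gh.
by apply: gh; exact: leqW.
Qed.

Lemma bernstein_affine n g a c x :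
  (bernstein n (fun k => a + c * g k)).[x] = a + c * (bernstein n g).[x].
Proof.
elim: n g => [|n IH] g; first by rewrite !hornerE.
by rewrite !bernsteinS !IH; ring.
Qed.

(** Second moment of the binomial law about y: variance plus squared bias. A success in the last
    trial shifts y by one. *)
Lemma bernstein_sqr n x y :
  (bernstein n (fun k => (k%:R - y) ^+ 2)).[x] =
  n%:R * (x * (1 - x)) + (n%:R * x - y) ^+ 2.
Proof.
elim: n y => [|n IH] y; first by rewrite hornerC; ring.
rewrite bernsteinS IH (_ : (fun k => _) = (fun k => (k%:R - (y - 1)) ^+ 2)).
  by rewrite IH -natr1; ring.
by apply/funext => k; rewrite -natr1; ring.
Qed.

(** Heine-Cantor, from compactness in its near-covering form: each point has a ball and a radius
    that work for all points of the ball. *)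
Lemma segment_unif_continuous f a b : {in `[a, b], continuous f} ->
  forall e, 0 < e -> exists2 d : R, 0 < d & forall x y : R,
    x \in `[a, b] -> y \in `[a, b] -> `|x - y| < d -> `|f x - f y| <= e.
Proof.
move=> fc e e0.
have /compact_near_coveringP/near_covering_withinP cab := @segment_compact _ a b.
pose P d x := forall y, y \in `[a, b] -> `|x - y| < d -> `|f x - f y| <= e.
have : \forall d \near 0^'+, `[a, b]%classic `<=` P d.
  apply: cab => x xab.
  have e2 : 0 < e / 2 by rewrite divr_gt0.
  have /cvgrPdist_le/(_ _ e2) := fc x xab.
  move=> -[d /= d0 fd].
  have d2 : 0 < d / 2 by rewrite divr_gt0.
  exists (ball x (d / 2), [set r | r < d / 2]) => /=.
    split; first exact: nbhsx_ballx.
    exact: nbhs_right_lt.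
  move=> [z r]/= [xz rd] zab y yab zy.
  have zd : ball x d z by apply: le_ball xz;
    rewrite ler_pdivrMr// mulr2n mulrDr mulr1 lerDl ltW.
  have yd : `|x - y| < d.
    rewrite (le_lt_trans (ler_distD z _ _))// [ltRHS]splitr ltrD//.
    exact: lt_trans rd.
  rewrite (le_trans (ler_distD (f x) _ _))// [leRHS]splitr lerD//.
    by rewrite distrC; apply: fd.
  by apply: fd.
move=> [d /= d0 dP]; exists (d / 2); first by rewrite divr_gt0.
move=> x y xab yab xy; apply: (dP (d / 2)) => //=.
- rewrite sub0r normrN ger0_norm ?divr_ge0 ?ltW//.
  by rewrite ltr_pdivrMr// mulr2n mulrDr mulr1 ltrDl.
- by rewrite divr_gt0.
Qed.

(** Chebyshev's argument for Bernstein polynomials: f(k/N) is within e/2 of f(x) when k/N is within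
    d of x; otherwise the difference is at most 2 S, hence at most 2 S (|k/N - x| / d)^2, whose
    expectation is small by [bernstein_sqr]. *)
Lemma weierstrass01 f : {in `[0, 1], continuous f} ->
  forall e, 0 < e -> exists q : {poly R},
  {in `[0, 1], forall t : R, `|q.[t] - f t| <= e}.
Proof.
move=> fc e e0.
have e2 : 0 < e / 2 by rewrite divr_gt0.
have [d d0 fd] := segment_unif_continuous fc e2.
have [S S0 fS] : exists2 S : R, 0 <= S & {in `[0, 1], forall t, `|f t| <= S}.
  have nc : {within `[(0:R), 1], continuous (fun t => `|f t|)}.
    apply: continuous_in_subspaceT => x; rewrite inE => x01.
    by apply: continuous_comp; [exact: fc | exact: norm_continuous].
  have [t _ tmax] := EVT_max ler01 nc.
  by exists `|f t|.
(* N is large enough for the expected quadratic error to be at most 2 S / (d^2 N) <= e / 2. *)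
pose N := (Num.truncn (4 * S / d ^+ 2 / e)).+1.
have N0 : 0 < N%:R :> R by rewrite ltr0n.
have SN : 2 * S / (d ^+ 2 * N%:R) <= e / 2.
  have : 4 * S / d ^+ 2 / e < N%:R by rewrite /N real_truncnS_gt// num_real.
  rewrite ltr_pdivrMr// => /ltW H.
  rewrite invfM mulrA ler_pdivrMr//; lra.
exists (bernstein N (fun k => f (k%:R / N%:R))) => x x01.
have /andP[x0 x1] : 0 <= x <= 1 by move: x01; rewrite in_itv.
pose c := 2 * S / (d * N%:R) ^+ 2.
have c0 : 0 <= c by apply: divr_ge0; [exact: mulr_ge0 | exact: sqr_ge0].
have key k : (k <= N)%N ->
    `|f (k%:R / N%:R) - f x| <= e / 2 + c * (k%:R - N%:R * x) ^+ 2.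
  move=> kN; have k01 : k%:R / N%:R \in `[(0 : R), 1].
    by rewrite in_itv/= divr_ge0//= ler_pdivrMr// mul1r ler_nat.
  have [kx|kx] := ltP (`|k%:R / N%:R - x|) d.
    by rewrite (le_trans (fd _ _ k01 x01 kx))// lerDl mulr_ge0 ?sqr_ge0.
  apply: (@le_trans _ _ (2 * S)).
    by rewrite (le_trans (ler_normB _ _))// mulrDl mul1r lerD ?fS.
  rewrite (_ : c * _ = 2 * S * ((`|k%:R / N%:R - x| / d) ^+ 2)).
    rewrite -[leLHS]mulr1 -[leLHS]add0r lerD// ?(ltW e2)//.
    by rewrite ler_wpM2l ?mulr_ge0// exprn_ege1// ler_pdivlMr// mul1r.
  rewrite expr_div_n real_normK ?num_real// /c.
  by field; rewrite !gt_eqF.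
have tail : c * (bernstein N (fun k => (k%:R - N%:R * x) ^+ 2)).[x] <= e / 2.
  rewrite bernstein_sqr subrr expr0n/= addr0 (le_trans _ SN)//.
  rewrite [leRHS](_ : _ = c * (N%:R * 1)); last first.
    by rewrite /c; field; rewrite !gt_eqF.
  rewrite ler_wpM2l// ler_wpM2l ?ler0n//.
  by rewrite (le_trans _ x1)// ler_piMr// gerBl.
have -> : f x = (f x + e) - e by ring.
rewrite ler_distl; apply/andP; split.
  apply: (@le_trans _ _ (bernstein N (fun k => (f x - e / 2) +
      (- c) * (k%:R - N%:R * x) ^+ 2)).[x]).
    rewrite bernstein_affine; lra.
  apply: le_bernstein; first by rewrite x0.
  move=> k /key; rewrite ler_distl => /andP[+ _]; lra.
apply: (@le_trans _ _ (bernstein N (fun k => (f x + e / 2) +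
      c * (k%:R - N%:R * x) ^+ 2)).[x]).
  apply: le_bernstein; first by rewrite x0.
  move=> k /key; rewrite ler_distl => /andP[_ +]; lra.
rewrite bernstein_affine; lra.
Qed.

Theorem weierstrass f a b : a < b -> {in `[a, b], continuous f} ->
  forall e, 0 < e -> exists q : {poly R},
  {in `[a, b], forall t : R, `|q.[t] - f t| <= e}.
Proof.
move=> ab fc e e0.
have ba0 : 0 < b - a by rewrite subr_gt0.
pose l s := a + (b - a) * s.
have lc : {in `[0, 1], continuous (f \o l)}.
  move=> x; rewrite in_itv/= => /andP[x0 x1]; apply: continuous_comp.
    by apply: cvgD; [exact: cvg_cst | apply: cvgM; [exact: cvg_cst|exact: cvg_id]].
  apply: fc; rewrite in_itv/= lerDl mulr_ge0 ?(ltW ba0)//=.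
  by rewrite -lerBrDl ler_piMr// ltW.
have [q qf] := weierstrass01 lc e0.
exists (q \Po ((b - a)^-1 *: ('X - a%:P))) => t; rewrite in_itv/= => /andP[at_ tb].
rewrite horner_comp !hornerE.
have : (b - a)^-1 * (t - a) \in `[0, 1].
  by rewrite in_itv/= mulr_ge0 ?invr_ge0 ?(ltW ba0) ?subr_ge0//= mulrC
    ler_pdivrMr// mul1r lerB.
move=> /qf; rewrite /= /l mulVKf ?gt_eqF// addrCA subrr addr0; exact.
Qed.

End Weierstrass.

(** * The real inner product *)

Lemma ler_addgt0_mul (R : realFieldType) (x y r : R) :
  (forall e, 0 < e -> x <= y + e * r) -> x <= y.
Proof.
move=> h; apply/ler_addgt0Pr => e e0.
have r1 : 0 < `|r| + 1 by rewrite ltr_pwDr.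
apply: (le_trans (h (e / (`|r| + 1)) (divr_gt0 e0 r1))); rewrite lerD2l.
rewrite mulrAC ler_pdivrMr// ler_wpM2l ?(ltW e0)//.
by rewrite (le_trans (ler_norm _))// lerDl.
Qed.

Section RealInner.
Context {R : realType} {H : hilbertType R}.
Implicit Types (x y z : H) (r : R) (a : R[i]).

(** The real part loses nothing, by [Im_inner], and together with the real-valued norm [hnorm] it
    keeps all estimates in the ordered field R. *)
Definition rinner x y : R := complex.Re (inner x y).
Definition hnorm x : R := Num.sqrt (rinner x x).

Lemma rinnerC x y : rinner x y = rinner y x.
Proof.
rewrite /rinner (hermC (@inner R H) x y) expr0 mul1r.
by rewrite -[LHS]/(complex.Re (conjc (inner y x))); case: (inner y x).
Qed.

Lemma rinnerDl x y z : rinner (x + y) z = rinner x z + rinner y z.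
Proof. by rewrite /rinner linearDl /= raddfD. Qed.

Lemma rinnerDr x y z : rinner x (y + z) = rinner x y + rinner x z.
Proof. by rewrite rinnerC rinnerDl !(rinnerC x). Qed.

Lemma rinnerNl x y : rinner (- x) y = - rinner x y.
Proof. by rewrite /rinner linearNl /= raddfN. Qed.

Lemma rinnerNr x y : rinner x (- y) = - rinner x y.
Proof. by rewrite rinnerC rinnerNl rinnerC. Qed.

Lemma rinner0r x : rinner x 0 = 0.
Proof. by rewrite -(subrr x) rinnerDr rinnerNr subrr. Qed.

Lemma rinner0l x : rinner 0 x = 0.
Proof. by rewrite rinnerC rinner0r. Qed.

Lemma rinnerZl r x y : rinner (r%:C *: x) y = r * rinner x y.
Proof.
rewrite /rinner linearZl_LR /=; case: (inner x y) => u v /=.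
by rewrite mul0r subr0.
Qed.

Lemma rinnerZr r x y : rinner x (r%:C *: y) = r * rinner x y.
Proof. by rewrite rinnerC rinnerZl rinnerC. Qed.

Definition rinnerE :=
  (rinnerDl, rinnerDr, rinnerNl, rinnerNr, rinnerZl, rinnerZr).

Lemma rinner_ii x y : rinner ('i%C *: x) ('i%C *: y) = rinner x y.
Proof.
rewrite /rinner linearZl_LR linearZr_LR /=; case: (inner x y) => u v.
by rewrite -[LHS]/(complex.Re ('i%C * (conjc 'i%C * (u +i* v)))) /=; ring.
Qed.

Lemma Im_inner x y : complex.Im (inner x y) = rinner x ('i%C *: y).
Proof.
rewrite /rinner linearZr_LR /=; case: (inner x y) => u v.
by rewrite -[RHS]/(complex.Re (conjc 'i%C * (u +i* v))) /=; ring.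
Qed.

Lemma rinner_il x y : rinner ('i%C *: x) y = - rinner x ('i%C *: y).
Proof.
by rewrite -(rinner_ii x) scalerA -expr2 sqr_i scaleN1r rinnerNr opprK.
Qed.

Lemma rinner_norm x : (rinner x x)%:C = `|x| ^+ 2.
Proof.
rewrite -inner_norm /rinner RRe_real// ger0_real//.
Qed.

Lemma rinner_ge0 x : 0 <= rinner x x.
Proof. by rewrite -ler0c rinner_norm exprn_ge0. Qed.

Lemma sqr_hnorm x : hnorm x ^+ 2 = rinner x x.
Proof. by rewrite sqr_sqrtr// rinner_ge0. Qed.

Lemma hnorm_ge0 x : 0 <= hnorm x.
Proof. exact: sqrtr_ge0. Qed.

Lemma normE x : `|x| = (hnorm x)%:C.
Proof.
apply/eqP; rewrite -(@eqrXn2 _ 2)//; last by rewrite ler0c hnorm_ge0.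
by rewrite -rinner_norm -sqr_hnorm rmorphXn.
Qed.

Lemma hnormE x : hnorm x = complex.Re `|x|.
Proof. by rewrite normE. Qed.

Lemma hnormD x y : hnorm (x + y) <= hnorm x + hnorm y.
Proof. by rewrite -lecR rmorphD /= -!normE ler_normD. Qed.

Lemma hnormZ a x : hnorm (a *: x) = complex.Re `|a| * hnorm x.
Proof.
apply: complexI; rewrite rmorphM /= -!normE normrZ; congr (_ * _).
Qed.

Lemma hnormZr r x : hnorm (r%:C *: x) = `|r| * hnorm x.
Proof. by rewrite hnormZ normc_def /= expr0n/= addr0 sqrtr_sqr. Qed.

Lemma hnormN x : hnorm (- x) = hnorm x.
Proof. by rewrite !hnormE normrN. Qed.

Lemma hnormB x y : hnorm (x - y) = hnorm (y - x).
Proof. by rewrite !hnormE distrC. Qed.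

Lemma hnorm0 : hnorm 0 = 0.
Proof. by rewrite hnormE normr0. Qed.

Lemma hnorm_gt0 x : (0 < hnorm x) = (x != 0).
Proof. by rewrite -normr_gt0 normE ltcR. Qed.

Lemma hnorm_eq0 x : hnorm x <= 0 -> x = 0.
Proof. by move=> h; apply/eqP; rewrite -[_ == _]negbK -hnorm_gt0 -leNgt. Qed.

Lemma hnorm_eps_eq0 x r : (forall e : R, 0 < e -> hnorm x <= e * r) -> x = 0.
Proof.
move=> h; apply/hnorm_eq0/(@ler_addgt0_mul _ _ _ r) => e e0.
by rewrite add0r; exact: h.
Qed.

(** Cauchy-Schwarz, read off the squared triangle inequality of the given norm. *)
Lemma rinner_le x y : rinner x y <= hnorm x * hnorm y.
Proof.
have := hnormD x y.
rewrite -ler_sqr ?nnegrE ?addr_ge0 ?hnorm_ge0// sqrrD !sqr_hnorm !rinnerE.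
by rewrite (rinnerC y x) mulr2n; lra.
Qed.

Lemma rinner_abs x y : `|rinner x y| <= hnorm x * hnorm y.
Proof.
rewrite ler_norml rinner_le andbT lerNl -rinnerNl.
by rewrite (le_trans (rinner_le _ _))// hnormN.
Qed.

Lemma hnorm_le x y : (hnorm x <= hnorm y) = (rinner x x <= rinner y y).
Proof. by rewrite -!sqr_hnorm ler_sqr// nnegrE hnorm_ge0. Qed.

Lemma hilbert_complete (u : nat -> H) (e : nat -> R) :
  (forall n m, (n <= m)%N -> hnorm (u m - u n) <= e n) ->
  (forall d : R, 0 < d -> exists n, e n <= d) ->
  exists l, forall n, hnorm (l - u n) <= e n.
Proof.
move=> ue e0.
have /cauchy_cvg/cvg_ex[l ul] : cauchy (u @ \oo).
  apply: cauchy_exP => d d0.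
  have [r rd] : exists r : R, d = r%:C by apply/complex_realP/gtr0_real.
  have r0 : 0 < r by rewrite -ltcR -rd.
  have [n en] := e0 (r / 2) (divr_gt0 r0 (ltr0Sn _ _)).
  exists (u n); exists n => // m /= nm.
  rewrite -ball_normE /= normE rd ltcR hnormB (le_lt_trans (ue _ _ nm))//.
  by rewrite (le_lt_trans en)// ltr_pdivrMr// mulr_natr mulr2n ltrDl.
exists l => n; apply/ler_addgt0Pr => d d0.
have /cvgrPdist_lt/(_ d%:C) := ul.
rewrite ltcR => /(_ d0)[N _ /(_ (maxn N n))/=] => /(_ (leq_maxl _ _)).
rewrite normE ltcR => /ltW h.
rewrite -(subrKA (u (maxn N n))) (le_trans (hnormD _ _))// addrC lerD//.
by rewrite ue// leq_maxr.
Qed.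

End RealInner.

(** * Bounds and invertibility of operators *)

Section OperatorBounds.
Context {R : realType} {H : hilbertType R}.
Implicit Types (x y z : H) (r c k q : R) (a : R[i]) (A B C S T : 'B(H)).

Lemma bopD A x y : A (x + y) = A x + A y.
Proof. by have := bop_linear A 1 x y; rewrite !scale1r. Qed.

Lemma bop0 A : A 0 = 0.
Proof. by apply: (addIr (A 0)); rewrite -bopD !add0r. Qed.

Lemma bopZ A a x : A (a *: x) = a *: A x.
Proof. by have := bop_linear A a x 0; rewrite !addr0 bop0 addr0. Qed.

Lemma bopN A x : A (- x) = - A x.
Proof. by rewrite -scaleN1r bopZ scaleN1r. Qed.

Lemma bopB A x y : A (x - y) = A x - A y.
Proof. by rewrite bopD bopN. Qed.

Lemma bop_scalerAr a A B : A * (a *: B) = a *: (A * B).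
Proof. by apply: bop_ext => x; exact: bopZ. Qed.

Lemma bop_scalerAl a A B : (a *: A) * B = a *: (A * B).
Proof. exact: bop_ext. Qed.

Lemma bop_addE A B x : (A + B) x = A x + B x. Proof. by []. Qed.
Lemma bop_oppE A x : (- A) x = - A x. Proof. by []. Qed.
Lemma bop_mulE A B x : (A * B) x = A (B x). Proof. by []. Qed.
Lemma bop_scaleE a A x : (a *: A) x = a *: A x. Proof. by []. Qed.
Lemma bop_oneE x : (1 : 'B(H)) x = x. Proof. by []. Qed.
Definition bopE := (bop_addE, bop_oppE, bop_mulE, bop_scaleE, bop_oneE).

Lemma bop_sumE (I : Type) (s : seq I) (F : I -> 'B(H)) x :
  (\sum_(i <- s) F i) x = \sum_(i <- s) F i x.
Proof. by elim/big_rec2: _ => // i y z _ <-. Qed.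

(** A bound on the operator norm as a predicate. A negative k is allowed; it forces H to be zero. *)
Definition norm_le A k := forall x, hnorm (A x) <= k * hnorm x.

Lemma norm_leW A k k' : k <= k' -> norm_le A k -> norm_le A k'.
Proof.
by move=> kk' Ak x; rewrite (le_trans (Ak x))// ler_wpM2r// hnorm_ge0.
Qed.

Lemma norm_le_ex A : exists2 k, 0 <= k & norm_le A k.
Proof.
have /bounded_operatorP/bounded_operator_ge0[k k0 Ak] := bop_subproof A.
have [r kr] : exists r : R, k = r%:C by apply/complex_realP/ger0_real.
exists r; first by rewrite -ler0c -kr.
by move=> x; have := Ak x; rewrite !normE kr -rmorphM lecR.
Qed.

Lemma norm_leD A B k l : norm_le A k -> norm_le B l -> norm_le (A + B) (k + l).
Proof.
by move=> Ak Bl x; rewrite bopE mulrDl (le_trans (hnormD _ _))// lerD.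
Qed.

Lemma norm_leN A k : norm_le A k -> norm_le (- A) k.
Proof. by move=> Ak x; rewrite bopE hnormN. Qed.

Lemma norm_leB A B k l : norm_le A k -> norm_le B l -> norm_le (A - B) (k + l).
Proof. by move=> Ak Bl; apply: norm_leD => //; exact: norm_leN. Qed.

Lemma norm_leM A B k l : 0 <= k ->
  norm_le A k -> norm_le B l -> norm_le (A * B) (k * l).
Proof.
by move=> k0 Ak Bl x; rewrite -mulrA (le_trans (Ak _))// ler_wpM2l.
Qed.

Lemma norm_leZ A r k : norm_le A k -> norm_le (r%:C *: A) (`|r| * k).
Proof. by move=> Ak x; rewrite bopE hnormZr -mulrA ler_wpM2l. Qed.

Lemma norm_le1 : norm_le 1 1.
Proof. by move=> x; rewrite bopE mul1r. Qed.

Lemma norm_le_eps_eq A B r : (forall e : R, 0 < e -> norm_le (A - B) (e * r)) ->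
  A = B.
Proof.
move=> h; apply: bop_ext => x; apply/eqP; rewrite -subr_eq0; apply/eqP.
apply: (@hnorm_eps_eq0 _ _ _ (r * hnorm x)) => e e0.
by rewrite mulrA; exact: h.
Qed.

(** The pointwise limit exists by completeness of H; it is linear because its linearity defect is at
    most a multiple of every e n, and bounded because it is close to S 0. *)
Lemma bop_complete (S : nat -> 'B(H)) (e : nat -> R) :
  (forall n m, (n <= m)%N -> norm_le (S m - S n) (e n)) ->
  (forall d : R, 0 < d -> exists n, e n <= d) ->
  exists T, forall n, norm_le (T - S n) (e n).
Proof.
move=> Se e0.
have /choice[l lS] x : exists l, forall n, hnorm (l - S n x) <= e n * hnorm x.
  apply: (@hilbert_complete _ _ (fun n => S n x)) => [n m nm|d d0].
    exact: Se.
  have x1 : 0 < hnorm x + 1 by rewrite ltr_wpDl// hnorm_ge0.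
  have [n en] := e0 _ (divr_gt0 d0 x1).
  exists n; rewrite (@le_trans _ _ (d / (hnorm x + 1) * hnorm x))//.
    by rewrite ler_wpM2r// hnorm_ge0.
  by rewrite mulrAC ler_pdivrMr// ler_wpM2l ?(ltW d0)// lerDl.
have llin : linear l.
  move=> a x y; apply/eqP; rewrite -subr_eq0; apply/eqP.
  apply: (@hnorm_eps_eq0 _ _ _ (hnorm (a *: x + y) + hnorm (a *: x) + hnorm y)).
  move=> d d0; have [n en] := e0 _ d0.
  have -> : l (a *: x + y) - (a *: l x + l y) =
      (l (a *: x + y) - S n (a *: x + y)) - a *: (l x - S n x) - (l y - S n y).
    rewrite bopD bopZ scalerBr !opprD !opprK !addrA.
    rewrite [RHS](ACl (1*4*6*(2*5)*(3*7)))/= (addrC (- _) (a *: S n x)) subrr.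
    by rewrite (addrC (- _) (S n y)) subrr !addr0.
  have dn z : hnorm (l z - S n z) <= d * hnorm z.
    by rewrite (le_trans (lS z n))// ler_wpM2r// hnorm_ge0.
  rewrite !mulrDr (le_trans (hnormD _ _))// lerD//; last by rewrite hnormN.
  rewrite (le_trans (hnormD _ _))// lerD// hnormN !hnormZ mulrCA.
  by rewrite ler_wpM2l// -ler0c RRe_real ?normr_real.
have lb : l \in bounded_operator.
  apply/bounded_operatorP; split=> //.
  have [k k0 Sk] := norm_le_ex (S 0).
  exists (e 0 + k)%:C => x; rewrite !normE -rmorphM lecR mulrDl.
  by rewrite -[l x](subrK (S 0 x)) (le_trans (hnormD _ _))// lerD.
by exists (Bop lb) => n x; exact: lS.
Qed.

Lemma opunitM A B : opunit A -> opunit B -> opunit (A * B).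
Proof.
move=> [A' [AA' A'A]] [B' [BB' B'B]]; exists (B' * A'); split.
  by rewrite mulrA -(mulrA A) BB' mulr1.
by rewrite mulrA -(mulrA B') A'A mulr1.
Qed.

(** If C inverts A B = B A, then B C is a right inverse of A, C B is a left inverse, and the two
    agree. *)
Lemma opunit_factor A B : A * B = B * A -> opunit (A * B) -> opunit A.
Proof.
move=> AB [C [ABC CAB]]; exists (B * C); split; first by rewrite mulrA.
suff -> : B * C = C * B by rewrite -mulrA -AB.
rewrite -[LHS]mul1r -CAB AB -!mulrA (mulrA A B C) ABC mulr1.
by [].
Qed.

Lemma opunitZ a A : a != 0 -> opunit A -> opunit (a *: A).
Proof.
move=> a0 [B [AB BA]]; exists (a^-1 *: B); split.
  by rewrite bop_scalerAl bop_scalerAr AB scalerA mulfV// scale1r.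
by rewrite bop_scalerAl bop_scalerAr BA scalerA mulVf// scale1r.
Qed.

Lemma opunitZE a A : a != 0 -> opunit (a *: A) -> opunit A.
Proof.
move=> a0 /(opunitZ (invr_neq0 a0)).
by rewrite scalerA mulVf// scale1r.
Qed.

Lemma opunitN A : opunit (- A) -> opunit A.
Proof. by rewrite -scaleN1r; apply: opunitZE; rewrite oppr_eq0 oner_eq0. Qed.

(** The geometric series of T converges with error q^n / (1 - q), and its partial sums telescope
    against 1 - T. *)
Lemma neumann T q : 0 <= q < 1 -> norm_le T q -> opunit (1 - T).
Proof.
move=> /andP[q0 q1] Tq.
have p0 : 0 < 1 - q by rewrite subr_gt0.
pose S n := \sum_(i < n) T ^+ i.
pose e n := q ^+ n / (1 - q).
have e_ge0 n : 0 <= e n by apply: divr_ge0; [exact: exprn_ge0 | exact: ltW].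
have Tn n : norm_le (T ^+ n) (q ^+ n).
  elim: n => [|n IH]; first exact: norm_le1.
  by rewrite !exprS; exact: norm_leM.
have Sn n : norm_le (S n) ((1 - q ^+ n) / (1 - q)).
  elim: n => [|n IH].
    by move=> x; rewrite /S big_ord0 expr0 subrr !mul0r hnorm0.
  rewrite /S big_ord_recr /= (_ : _ / _ = (1 - q ^+ n) / (1 - q) + q ^+ n).
    exact: norm_leD.
  by rewrite exprS; field; rewrite gt_eqF.
have en (d : R) : 0 < d -> exists n, e n <= d.
  move=> d0.
  have := @cvg_expr R q; rewrite ger0_norm// => /(_ q1)/cvgrPdist_le/(_ (d * (1 - q))).
  rewrite mulr_gt0// => /(_ isT)[N _ /(_ N (leqnn _))] /=.
  rewrite sub0r normrN ger0_norm ?exprn_ge0// => h.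
  by exists N; rewrite ler_pdivrMr.
have [L LS] : exists L, forall n, norm_le (L - S n) (e n).
  apply: bop_complete => // n m nm.
  rewrite -(subnKC nm) (_ : _ - _ = S (m - n)%N * T ^+ n).
    apply: (@norm_leW _ ((1 - q ^+ (m - n)) / (1 - q) * q ^+ n)).
      rewrite mulrAC /e ler_pM2r ?invr_gt0// ler_piMl ?exprn_ge0//.
      by rewrite lerBlDr lerDl exprn_ge0.
    apply: norm_leM => //.
    by rewrite divr_ge0// ?(ltW p0)// subr_ge0 exprn_ile1// ltW.
  rewrite /S big_split_ord/= addrAC subrr add0r mulr_suml.
  by apply: eq_bigr => i _; rewrite -exprD addnC.
have [k k0 Lk] := norm_le_ex (1 - T).
have qe n : q ^+ n <= e n.
  by rewrite ler_pdivlMr// ler_piMr ?exprn_ge0// gerBl.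
have TS n : (1 - T) * S n = 1 - T ^+ n.
  by rewrite -opprB mulNr -subrX1 opprB.
have ST n : S n * (1 - T) = 1 - T ^+ n.
  rewrite -TS /S mulr_sumr mulr_suml; apply: eq_bigr => i _.
  by rewrite mulrBl mulrBr mul1r mulr1 -exprS -exprSr.
exists L; split; apply: (@norm_le_eps_eq _ _ (k + 1)) => d /en[n nd].
  have -> : (1 - T) * L - 1 = (1 - T) * (L - S n) - T ^+ n.
    by rewrite mulrBr TS opprB -addrA [in RHS]addrAC subrr sub0r.
  apply: (@norm_leW _ (k * e n + q ^+ n)).
    by rewrite mulrDr mulr1 mulrC lerD// ?ler_wpM2r// (le_trans (qe n)).
  by apply: norm_leB => //; exact: norm_leM.
have -> : L * (1 - T) - 1 = (L - S n) * (1 - T) - T ^+ n.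
  by rewrite mulrBl ST opprB -addrA [in RHS]addrAC subrr sub0r.
apply: (@norm_leW _ (e n * k + q ^+ n)).
  by rewrite mulrDr mulr1 lerD// ?ler_wpM2r// (le_trans (qe n)).
by apply: norm_leB => //; exact: norm_leM.
Qed.

(** If k bounds A, then |x - s A x|^2 <= (1 - 2 s c + s^2 k^2) |x|^2. The minimum over s is at s = c
    / k^2 and equals 1 - (c / k)^2 < 1, so [neumann] inverts s A. *)
Lemma lax_milgram A c : 0 < c -> (forall x, c * rinner x x <= rinner (A x) x) ->
  opunit A.
Proof.
move=> c0 Ac.
have [k0 k00 Ak0] := norm_le_ex A.
pose k := k0 + c.
have k_gt0 : 0 < k by rewrite ltr_wpDl.
have Ak : norm_le A k by apply: norm_leW Ak0; rewrite lerDl ltW.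
have ck : c <= k by rewrite lerDr.
pose s := c / k ^+ 2.
have s0 : 0 < s by rewrite divr_gt0// exprn_gt0.
have r0 : 0 <= 1 - (c / k) ^+ 2.
  rewrite subr_ge0 exprn_ile1//; first by rewrite divr_ge0// ltW.
  by rewrite ler_pdivrMr// mul1r.
pose q := Num.sqrt (1 - (c / k) ^+ 2).
have q1 : 0 <= q < 1.
  rewrite sqrtr_ge0/= -sqrtr1 ltr_sqrt// gtrBl.
  by rewrite exprn_gt0// divr_gt0.
have Tq : norm_le (1 - s%:C *: A) q.
  move=> x; rewrite -ler_sqr ?nnegrE ?mulr_ge0 ?hnorm_ge0 ?sqrtr_ge0//.
  rewrite exprMn !sqr_hnorm sqr_sqrtr// !bopE.
  rewrite !rinnerE (rinnerC x (A x)).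
  have Akx : rinner (A x) (A x) <= k ^+ 2 * rinner x x.
    by rewrite -!sqr_hnorm -exprMn ler_sqr ?nnegrE ?mulr_ge0 ?hnorm_ge0 ?(ltW k_gt0).
  have /(ler_wpM2l (ltW s0)) h1 := Ac x.
  have /(ler_wpM2l (sqr_ge0 s)) h2 := Akx.
  have e1 : s * (c * rinner x x) = (c / k) ^+ 2 * rinner x x.
    by rewrite /s; field; rewrite gt_eqF.
  have e2 : s ^+ 2 * (k ^+ 2 * rinner x x) = (c / k) ^+ 2 * rinner x x.
    by rewrite /s; field; rewrite gt_eqF.
  rewrite e1 in h1; rewrite e2 expr2 -mulrA in h2.
  lra.
apply: (@opunitZE s%:C); first by rewrite gt_eqF// ltcR.
by have := neumann q1 Tq; rewrite opprB addrCA subrr addr0.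
Qed.

Definition selfadj A := forall x y, rinner (A x) y = rinner x (A y).

(** Polarization: a quadratic form that is real on the complex space H comes from a self-adjoint
    operator. *)
Lemma opge0P A : opge0 A <-> selfadj A /\ forall x, 0 <= rinner (A x) x.
Proof.
split=> [A0|[sA A0] x]; last first.
  rewrite lecE /= A0 andbT Im_inner.
  have h : rinner (A x) ('i%C *: x) = - rinner (A x) ('i%C *: x).
    by rewrite {1}sA bopZ rinnerC rinner_il.
  by apply/eqP; lra.
split=> [x y|x]; last by have := A0 x; rewrite lecE => /andP[].
have h u : rinner (A u) ('i%C *: u) = 0.
  by rewrite -Im_inner; apply: ger0_Im; exact: A0.
have ii (u : H) : 'i%C *: (- 'i%C *: u) = u.
  by rewrite scalerA mulrN -expr2 sqr_i opprK scale1r.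
(* In the vanishing imaginary part at x - i y only the cross terms survive, and they state the
   symmetry. *)
have := h (x + - 'i%C *: y).
rewrite scalerDr !bopD !rinnerE !h ii add0r addr0.
rewrite bopZ scaleNr rinnerNl rinner_ii => /eqP; rewrite subr_eq0 => /eqP ->.
exact: rinnerC.
Qed.

Lemma selfadj1 : selfadj 1.
Proof. by []. Qed.

Lemma selfadjD A B : selfadj A -> selfadj B -> selfadj (A + B).
Proof. by move=> sA sB x y; rewrite !bopE rinnerDl rinnerDr sA sB. Qed.

Lemma selfadjN A : selfadj A -> selfadj (- A).
Proof. by move=> sA x y; rewrite !bopE rinnerNl rinnerNr sA. Qed.

Lemma selfadjB A B : selfadj A -> selfadj B -> selfadj (A - B).
Proof. by move=> sA sB; apply: selfadjD => //; exact: selfadjN. Qed.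

Lemma selfadjZ r A : selfadj A -> selfadj (r%:C *: A).
Proof. by move=> sA x y; rewrite !bopE rinnerZl rinnerZr sA. Qed.

Lemma selfadjM A B : selfadj A -> selfadj B -> A * B = B * A ->
  selfadj (A * B).
Proof. by move=> sA sB AB x y; rewrite bopE sA sB -bop_mulE -AB. Qed.

Lemma selfadj_conj A S : selfadj A -> selfadj S -> selfadj (S * A * S).
Proof. by move=> sA sS x y; rewrite !bopE sS sA sS. Qed.

Lemma selfadj_sum (I : Type) (s : seq I) (F : I -> 'B(H)) :
  (forall i, selfadj (F i)) -> selfadj (\sum_(i <- s) F i).
Proof.
move=> sF; elim/big_ind: _ => //; last exact: selfadjD.
by move=> x y; exact: etrans (rinner0l y) (esym (rinner0r x)).
Qed.

(** Invertibility gives |x| <= l |A x| and positivity gives |A x|^2 <= k <A x, x>; together they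
    bound the form away from zero. The converse is [lax_milgram]. *)
Lemma opgt0P A : opgt0 A <->
  selfadj A /\ exists2 c, 0 < c & forall x, c * rinner x x <= rinner (A x) x.
Proof.
split=> [[/opge0P[sA A0] [B [AB BA]]]|[sA [c c0 Ac]]]; last first.
  split; last exact: lax_milgram Ac.
  apply/opge0P; split=> // x.
  by rewrite (le_trans _ (Ac x))// mulr_ge0 ?(ltW c0) ?rinner_ge0.
split=> //.
have [k0 k00 Ak0] := norm_le_ex A.
have [l0 l00 Bl0] := norm_le_ex B.
pose k := k0 + 1; pose l := l0 + 1.
have k_gt0 : 0 < k by rewrite ltr_wpDl.
have l_gt0 : 0 < l by rewrite ltr_wpDl.
have Ak : norm_le A k by apply: norm_leW Ak0; rewrite lerDl.
have Bl : norm_le B l by apply: norm_leW Bl0; rewrite lerDl.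
exists (l ^+ 2 * k)^-1; first by rewrite invr_gt0 mulr_gt0 ?exprn_gt0.
move=> x; rewrite mulrC ler_pdivrMr ?mulr_gt0 ?exprn_gt0//.
have xA : rinner x x <= l ^+ 2 * rinner (A x) (A x).
  have := Bl (A x); rewrite -bop_mulE BA bopE => h.
  rewrite -!sqr_hnorm -exprMn ler_sqr ?nnegrE ?mulr_ge0 ?hnorm_ge0//.
  exact: ltW.
have AA : rinner (A (A x)) (A x) <= k * rinner (A x) (A x).
  rewrite (le_trans (rinner_le _ _))// (le_trans (ler_wpM2r (hnorm_ge0 _) (Ak _)))//.
  by rewrite -mulrA -expr2 sqr_hnorm.
(* The discriminant argument in the semi-inner product [<A x, y>]. *)
have kAx : rinner (A x) (A x) <= k * rinner (A x) x.
  have := A0 (x - k^-1%:C *: A x).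
  rewrite bopB bopZ !rinnerE (sA (A x) x).
  have ki : 0 < k^-1 by rewrite invr_gt0.
  have /(ler_wpM2l (ltW ki))/(ler_wpM2l (ltW ki)) := AA.
  rewrite [k^-1 * (k * _)]mulKf ?gt_eqF// => h1 h2.
  have : k^-1 * rinner (A x) (A x) <= rinner (A x) x by lra.
  by rewrite mulrC ler_pdivrMr// mulrC.
by apply: (le_trans xA); rewrite [leRHS]mulrCA ler_pM2l ?exprn_gt0// mulrC.
Qed.

End OperatorBounds.

(** * Spectrum of self-adjoint operators *)

Section SpectralBound.
Context {R : realType} {H : hilbertType R}.
Implicit Types (x y z : H) (r c k e : R) (a : R[i]) (A B C S T : 'B(H)).

Local Notation "a %:B" := (a *: (1 : 'B(H))) (at level 2, format "a %:B").

Lemma selfadj_scalar r : selfadj (r%:C *: (1 : 'B(H))).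
Proof. by apply: selfadjZ; exact: selfadj1. Qed.

Lemma norm_le_sup A : exists2 N : R, norm_le A N &
  forall k, (forall x, hnorm x <= 1 -> hnorm (A x) <= k) -> N <= k.
Proof.
pose E : set R := [set hnorm (A x) | x in [set x | hnorm x <= 1]].
have E0 : E !=set0 by exists (hnorm (A 0)), 0 => //=; rewrite hnorm0 ler01.
have [k k0 Ak] := norm_le_ex A.
have Eub : has_ubound E.
  exists k => _ [x /= x1 <-]; rewrite (le_trans (Ak x))//.
  by rewrite ler_piMr.
exists (sup E); last first.
  by move=> l Al; apply: ge_sup => // _ [x /= x1 <-]; exact: Al.
move=> x; have [->|x0] := eqVneq x 0; first by rewrite bop0 hnorm0 mulr0.
rewrite -hnorm_gt0 in x0.
rewrite -ler_pdivrMr//; apply: ub_le_sup => //.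
exists ((hnorm x)^-1%:C *: x) => /=.
  by rewrite hnormZr ger0_norm ?invr_ge0 ?hnorm_ge0// mulVf// gt_eqF.
by rewrite bopZ hnormZr ger0_norm ?invr_ge0 ?hnorm_ge0// mulrC.
Qed.

(* The norm N of T is attained up to epsilon at unit vectors, where            *)
(* [|(N^2 - T^2) x|^2 <= N^2 (N^2 - |T x|^2)] is then small: N^2 - T^2 is not  *)
(* invertible, so N or - N is in the spectrum.                                 *)
Lemma selfadj_norm_le T e : selfadj T -> (exists x : H, x != 0) ->
  (forall r, ~ opunit (T - r%:C%:B) -> `|r| <= e) -> norm_le T e.
Proof.
move=> sT [x0 x00] Te.
have [N TN Nmin] := norm_le_sup T.
have [|eN] := leP N e; first by move=> Ne; exact: norm_leW TN.
have N0 : 0 <= N.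
  have := TN x0; rewrite -ler_pdivrMr ?hnorm_gt0//; apply: le_trans.
  by rewrite divr_ge0// hnorm_ge0.
have uN : opunit (T - N%:C%:B).
  by apply: contrapT => /Te; rewrite ger0_norm// leNgt eN.
have uNN : opunit (T - (- N)%:C%:B).
  by apply: contrapT => /Te; rewrite normrN ger0_norm// leNgt eN.
have [G [_ GT]] := opunitM uN uNN.
have [k k0 Gk] := norm_le_ex G.
have GTx x : hnorm x <= k * hnorm (T (T x) - (N ^+ 2)%:C *: x).
  have := Gk (((T - N%:C%:B) * (T - (- N)%:C%:B)) x).
  have NC : (- N)%:C = - N%:C by rewrite rmorphN.
  rewrite -bop_mulE GT !bopE NC scaleNr opprK bopD bopZ.
  congr (_ <= k * hnorm _).
  by rewrite scalerDr scalerA opprD addrA addrK expr2 rmorphM.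
pose C := N ^+ 4 * k ^+ 2.
have C0 : 0 <= C by rewrite mulr_ge0 ?exprn_ge0.
have C1 : 0 < 1 + C by rewrite ltr_wpDr.
have CC : 0 <= N ^+ 2 * (C / (1 + C)).
  by rewrite mulr_ge0 ?sqr_ge0// divr_ge0// ltW.
have Tbound x : hnorm x <= 1 -> hnorm (T x) <= Num.sqrt (N ^+ 2 * (C / (1 + C))).
  move=> x1; rewrite -ler_sqr ?nnegrE ?hnorm_ge0 ?sqrtr_ge0//.
  rewrite [leRHS]sqr_sqrtr//.
  have TT : hnorm (T (T x)) ^+ 2 <= N ^+ 2 * hnorm (T x) ^+ 2.
    by rewrite -exprMn ler_sqr ?nnegrE ?mulr_ge0 ?hnorm_ge0.
  have Tx : hnorm (T x) ^+ 2 <= N ^+ 2 * hnorm x ^+ 2.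
    by rewrite -exprMn ler_sqr ?nnegrE ?mulr_ge0 ?hnorm_ge0.
  have x2 : hnorm x ^+ 2 <= 1 by rewrite expr_le1// hnorm_ge0.
  have : hnorm x ^+ 2 <= (k * hnorm (T (T x) - (N ^+ 2)%:C *: x)) ^+ 2.
    by rewrite ler_sqr ?nnegrE ?mulr_ge0 ?hnorm_ge0.
  rewrite exprMn (sqr_hnorm (_ - _)) !rinnerE.
  rewrite (rinnerC x (T (T x))) (sT (T x) x) -!sqr_hnorm => xk.
  set y := hnorm (T x) ^+ 2 in TT Tx xk *.
  have y0 : 0 <= y by rewrite sqr_ge0.
  have N2 : 0 <= N ^+ 2 by rewrite sqr_ge0.
  have {}xk : hnorm x ^+ 2 <= k ^+ 2 * (N ^+ 2 * (N ^+ 2 - y)).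
    apply: (le_trans xk); rewrite ler_wpM2l ?sqr_ge0//.
    have := ler_wpM2l (mulr_ge0 N2 N2) x2; lra.
  have {}Tx : y <= C * (N ^+ 2 - y).
    apply: (le_trans Tx); rewrite (le_trans (ler_wpM2l N2 xk))//.
    by rewrite [leLHS](_ : _ = C * (N ^+ 2 - y))// /C; ring.
  rewrite mulrA ler_pdivlMr//; lra.
(* On the unit ball |T x|^2 is at most N^2 C / (1 + C), so minimality of N forces N = 0. Then T
   kills x0, although T - N is invertible. *)
have := Nmin _ Tbound.
rewrite -ler_sqr ?nnegrE ?sqrtr_ge0// sqr_sqrtr//.
rewrite mulrA ler_pdivlMr// mulrDr mulr1 gerDr => N2.
have {}N2 : N = 0 by apply/eqP; rewrite -sqrf_eq0 eq_le N2 sqr_ge0.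
have T0 : T x0 = 0 by apply: hnorm_eq0; rewrite (le_trans (TN x0))// N2 mul0r.
have [B [_ BT]] := uN.
move: x00; have -> : x0 = (B * (T - N%:C%:B)) x0 by rewrite BT.
by rewrite !bopE T0 N2 scale0r subrr bop0 eqxx.
Qed.

Lemma bop_subr_sqr A a : (A - a%:B) * (A + a%:B) = A * A - (a * a)%:B.
Proof.
rewrite mulrDr !mulrBl !(bop_scalerAl, bop_scalerAr) !mulr1 mul1r scalerA.
by rewrite addrA subrK.
Qed.

Lemma bop_addr_sqr A a : (A + a%:B) * (A - a%:B) = A * A - (a * a)%:B.
Proof. by have := bop_subr_sqr A (- a); rewrite scaleNr opprK mulrNN. Qed.

(** For D = A - u, the product (D - i v)(D + i v) = D^2 + v^2 is coercive when v is not 0, hence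
    invertible, and so is its commuting factor D - i v. *)
Lemma selfadj_spectrum_real A a : selfadj A -> spectrum A a -> a = (complex.Re a)%:C.
Proof.
case: a => u v sA Aa; suff -> : v = 0 by [].
apply: contrapT => /eqP v0; apply: Aa.
pose D := A - u%:C%:B; pose c := 'i%C * v%:C : R[i].
have c2 : c * c = (- v ^+ 2)%:C.
  by rewrite mulrACA -expr2 sqr_i mulN1r -rmorphM -rmorphN expr2.
have DE : A - (u +i* v)%:B = D - c%:B.
  by rewrite (complexE (u +i* v)) /= scalerDl opprD addrA.
rewrite DE; apply: (@opunit_factor _ _ _ (D + c%:B)).
  by rewrite (bop_subr_sqr D) bop_addr_sqr.
have v2 : 0 < v ^+ 2 by rewrite exprn_even_gt0.
rewrite bop_subr_sqr c2; apply: (lax_milgram v2) => x.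
rewrite rmorphN scaleNr opprK !bopE rinnerDl rinnerZl lerDr.
have -> : rinner (D (D x)) x = rinner (D x) (D x).
  by apply: selfadjB => //; exact: selfadj_scalar.
exact: rinner_ge0.
Qed.

Lemma spectrum_itv A u v : selfadj A ->
  (forall x, u * rinner x x <= rinner (A x) x <= v * rinner x x) ->
  forall t, spectrum A t%:C -> u <= t <= v.
Proof.
move=> sA Auv t At; apply/andP; split; rewrite leNgt; apply/negP => tu; apply: At.
  have ut : 0 < u - t by rewrite subr_gt0.
  apply: (lax_milgram ut) => x; have /andP[+ _] := Auv x.
  by rewrite !bopE !rinnerE; lra.
have ut : 0 < t - v by rewrite subr_gt0.
apply: opunitN; apply: (lax_milgram ut) => x; have /andP[_ +] := Auv x.
by rewrite !bopE !rinnerE; lra.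
Qed.

Lemma selfadj_itv A k : norm_le A k ->
  forall x, - k * rinner x x <= rinner (A x) x <= k * rinner x x.
Proof.
move=> Ak x; rewrite mulNr -ler_norml (le_trans (rinner_abs _ _))//.
by rewrite -sqr_hnorm expr2 mulrA ler_wpM2r ?hnorm_ge0.
Qed.

End SpectralBound.

(** * Functional calculus *)

Section Calculus.
Context {R : realType} {H : hilbertType R}.
Implicit Types (x y z : H) (r c k e t : R) (a : R[i]) (A B C S T : 'B(H)).
Implicit Types (p q : {poly R}) (P Q : {poly R[i]}) (f g : R -> R).

Local Notation "a %:B" := (a *: (1 : 'B(H))) (at level 2, format "a %:B").

(** Complex coefficients allow a real polynomial to be split into linear factors in
    [spectrum_opoly]. *)
Definition hpoly (P : {poly R[i]}) A : 'B(H) := \sum_(i < size P) P`_i *: A ^+ i.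

Lemma hpoly_wide n P A : (size P <= n)%N ->
  hpoly P A = \sum_(i < n) P`_i *: A ^+ i.
Proof.
move=> Pn; rewrite /hpoly (big_ord_widen _ (fun i => P`_i *: A ^+ i) Pn).
rewrite big_mkcond; apply: eq_bigr => i _.
by case: ltnP => // Pi; rewrite nth_default// scale0r.
Qed.

Lemma hpolyD P Q A : hpoly (P + Q) A = hpoly P A + hpoly Q A.
Proof.
pose n := maxn (size P) (size Q).
rewrite !(@hpoly_wide n) ?leq_maxl ?leq_maxr ?size_polyD// -big_split/=.
by apply: eq_bigr => i _; rewrite coefD scalerDl.
Qed.

Lemma hpolyZ a P A : hpoly (a *: P) A = a *: hpoly P A.
Proof.
rewrite (@hpoly_wide (size P)) ?size_scale_leq// scaler_sumr.
by apply: eq_bigr => i _; rewrite coefZ scalerA.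
Qed.

Lemma hpolyC a A : hpoly a%:P A = a%:B.
Proof.
by rewrite (@hpoly_wide 1%N) ?size_polyC_leq1// big_ord1 coefC expr0.
Qed.

Lemma hpolyMX P A : hpoly (P * 'X) A = hpoly P A * A.
Proof.
rewrite (@hpoly_wide (size P).+1); last first.
  by rewrite (leq_trans (size_polyMleq _ _))// size_polyX addn2.
rewrite big_ord_recl coefMX/= scale0r add0r mulr_suml.
by apply: eq_bigr => i _; rewrite coefMX/= bop_scalerAl exprSr.
Qed.

Lemma hpolyM P Q A : hpoly (P * Q) A = hpoly P A * hpoly Q A.
Proof.
elim/poly_ind: Q => [|Q c IH].
  by rewrite mulr0 -polyC0 hpolyC scale0r mulr0.
rewrite mulrDr mulrA !hpolyD !hpolyMX IH [P * _]mulrC mul_polyC hpolyZ hpolyC.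
by rewrite mulrDr mulrA bop_scalerAr mulr1.
Qed.

Lemma hpolyX A : hpoly 'X A = A.
Proof. by rewrite -['X]mul1r hpolyMX -polyC1 hpolyC scale1r mul1r. Qed.

Lemma hpolyXsubC a A : hpoly ('X - a%:P) A = A - a%:B.
Proof. by rewrite hpolyD -polyCN hpolyC hpolyX scaleNr. Qed.

Lemma opolyE q A : opoly q A = hpoly (map_poly (real_complex R) q) A.
Proof.
rewrite /hpoly size_map_poly; apply: eq_bigr => i _.
by rewrite coef_map.
Qed.

Lemma opolyD p q A : opoly (p + q) A = opoly p A + opoly q A.
Proof. by rewrite !opolyE rmorphD hpolyD. Qed.

Lemma opolyM p q A : opoly (p * q) A = opoly p A * opoly q A.
Proof. by rewrite !opolyE rmorphM hpolyM. Qed.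

Lemma opolyC c A : opoly c%:P A = c%:C%:B.
Proof. by rewrite !opolyE map_polyC hpolyC. Qed.

Lemma opolyN q A : opoly (- q) A = - opoly q A.
Proof.
by rewrite -mulN1r -polyCN opolyM opolyC rmorphN scaleNr scale1r mulN1r.
Qed.

Lemma opolyB p q A : opoly (p - q) A = opoly p A - opoly q A.
Proof. by rewrite opolyD opolyN. Qed.

Lemma opolyX A : opoly 'X A = A.
Proof. by rewrite opolyE map_polyX hpolyX. Qed.

Lemma opoly_eigen q A t x : A x = t%:C *: x -> opoly q A x = q.[t]%:C *: x.
Proof.
move=> Ax; rewrite /opoly bop_sumE horner_coef rmorph_sum scaler_suml.
apply: eq_bigr => i _; rewrite bopE rmorphM -scalerA; congr (_ *: _).
elim: {i}(i : nat) => [|i IH]; first by rewrite scale1r.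
by rewrite exprSr bopE Ax bopZ IH scalerA -rmorphM -exprS.
Qed.

Lemma selfadj_opoly q A : selfadj A -> selfadj (opoly q A).
Proof.
move=> sA; apply: selfadj_sum => i; apply: selfadjZ.
elim: {i}(i : nat) => [|i IH]; first exact: selfadj1.
by rewrite exprS; apply: selfadjM => //; rewrite -exprS -exprSr.
Qed.

(** With an empty spectrum [selfadj_norm_le] would bound A by -1. *)
Lemma spectrum_neq0 A : selfadj A -> (exists x : H, x != 0) ->
  exists t, spectrum A t%:C.
Proof.
move=> sA H0; apply: contrapT => /forallNP At.
have A0 : norm_le A (-1) by apply: selfadj_norm_le => // r /(At r).
have [x x0] := H0; have := A0 x.
rewrite leNgt (lt_le_trans _ (hnorm_ge0 _))//.
by rewrite mulN1r oppr_lt0 hnorm_gt0.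
Qed.

(** Split q - r into complex linear factors. If every A - z were invertible, so would be q(A) - r;
    hence some root z lies in the spectrum of A, and it is real as A is self-adjoint. *)
Lemma spectrum_opoly q A r : selfadj A -> (exists x : H, x != 0) ->
  spectrum (opoly q A) r%:C -> exists2 t, spectrum A t%:C & q.[t] = r.
Proof.
move=> sA H0 qr.
pose Q := map_poly (real_complex R) (q - r%:P).
have QE : opoly q A - r%:C%:B = hpoly Q A by rewrite -opolyE opolyB opolyC.
have [q0|Q0] := eqVneq (q - r%:P) 0.
  have [t At] := spectrum_neq0 sA H0; exists t => //.
  by move/eqP: q0; rewrite subr_eq0 => /eqP ->; rewrite hornerC.
have [s Qs] := closed_field_poly_normal Q.
have [z sz Az] : exists2 z : R[i], z \in s & spectrum A z.
  apply: contrapT => nz; apply: qr; rewrite QE Qs hpolyZ.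
  apply: opunitZ; first by rewrite lead_coef_eq0 map_poly_eq0.
  have {nz} : forall z : R[i], z \in s -> opunit (A - z%:B).
    by move=> z sz; apply: contrapT => Az; apply: nz; exists z.
  elim: s {Qs} => [|z s IH] As.
    by rewrite big_nil -polyC1 hpolyC scale1r; exists 1; rewrite mulr1.
  rewrite big_cons hpolyM hpolyXsubC; apply: opunitM.
    by apply: As; rewrite mem_head.
  by apply: IH => w ws; apply: As; rewrite inE ws orbT.
have zE := selfadj_spectrum_real sA Az.
exists (complex.Re z); first by rewrite -zE.
have : root Q z.
  rewrite Qs rootE hornerZ horner_prod (big_rem z)//= hornerXsubC subrr.
  by rewrite mul0r mulr0.
rewrite zE rootE horner_map => /eqP/(congr1 (@complex.Re R))/=.
by rewrite !hornerE => /eqP; rewrite subr_eq0 => /eqP.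
Qed.

Lemma opoly_norm_le q A e : selfadj A -> 0 <= e ->
  (forall t, spectrum A t%:C -> `|q.[t]| <= e) -> norm_le (opoly q A) e.
Proof.
move=> sA e0 qe x.
have [->|x0] := eqVneq x 0; first by rewrite bop0 hnorm0 mulr0.
have H0 : exists x : H, x != 0 by exists x.
apply: selfadj_norm_le => //; first exact: selfadj_opoly.
by move=> r /(spectrum_opoly sA H0)[t At <-]; exact: qe.
Qed.

Lemma spectrum_poly_bounded q A : selfadj A ->
  exists2 c, 0 <= c & forall t, spectrum A t%:C -> `|q.[t]| <= c.
Proof.
move=> sA; have [k k0 Ak] := norm_le_ex A.
have At t : spectrum A t%:C -> `|t| <= k.
  by move=> /(spectrum_itv sA (selfadj_itv Ak)); rewrite ler_norml.
elim/poly_ind: q => [|q c [b b0 qb]].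
  by exists 0 => // t _; rewrite horner0 normr0.
exists (b * k + `|c|); first by rewrite addr_ge0// mulr_ge0.
move=> t tA; rewrite !hornerE (le_trans (ler_normD _ _))// lerD//.
by rewrite normrM ler_pM// ?qb// At.
Qed.

(** If 0 <= q <= c on the spectrum, then |q - c/2| <= c/2 there, so q(A) - c/2 has norm at most
    c/2. *)
Lemma opoly_ge0 q A : selfadj A -> (forall t, spectrum A t%:C -> 0 <= q.[t]) ->
  forall x, 0 <= rinner (opoly q A x) x.
Proof.
move=> sA q0 x; have [c c0 qc] := spectrum_poly_bounded q sA.
have h : norm_le (opoly (q - (c / 2)%:P) A) (c / 2).
  apply: opoly_norm_le => //; first by rewrite divr_ge0.
  move=> t tA; rewrite !hornerE ler_norml.
  by have := q0 t tA; have := qc t tA; rewrite ler_norml; lra.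
have /andP[+ _] := selfadj_itv h x.
by rewrite opolyB opolyC !bopE !rinnerE; lra.
Qed.

Lemma is_cfcP f A B : is_cfc f A B <-> forall e, 0 < e -> exists2 q,
  (forall t, spectrum A t%:C -> `|q.[t] - f t| <= e) & norm_le (opoly q A - B) e.
Proof.
split=> h e /h.
  move=> [q [qf qB]]; exists q => // x; have := qB x.
  by rewrite !normE -rmorphM lecR !bopE.
move=> [q qf qB]; exists q; split=> // x.
by rewrite !normE -rmorphM lecR; exact: qB.
Qed.

Lemma cfc_opoly q A : is_cfc (fun t => q.[t]) A (opoly q A).
Proof.
apply/is_cfcP => e e0; exists q => [t _|x].
  by rewrite subrr normr0 ltW.
by rewrite subrr hnorm0 mulr_ge0 ?hnorm_ge0 ?(ltW e0).
Qed.

Lemma cfc_sub f g A B C : is_cfc f A B -> is_cfc g A C ->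
  is_cfc (fun t => f t - g t) A (B - C).
Proof.
move=> /is_cfcP fB /is_cfcP gC; apply/is_cfcP => e e0.
have e2 : 0 < e / 2 by rewrite divr_gt0.
have [p pf pB] := fB _ e2; have [q qg qC] := gC _ e2.
exists (p - q) => [t tA|].
  rewrite !hornerE (_ : _ - _ = (p.[t] - f t) - (q.[t] - g t)); last by ring.
  by rewrite (le_trans (ler_normB _ _))// [leRHS]splitr lerD ?pf ?qg.
rewrite opolyB (_ : _ - _ = (opoly p A - B) - (opoly q A - C)).
  by rewrite [e]splitr; exact: norm_leB.
by rewrite !opprD addrACA.
Qed.

Lemma cfc_norm_le f A B e : selfadj A -> 0 <= e -> is_cfc f A B ->
  (forall t, spectrum A t%:C -> `|f t| <= e) -> norm_le B e.
Proof.
move=> sA e0 /is_cfcP fB fe x.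
apply: (@ler_addgt0_mul _ _ _ (2 * hnorm x)) => d d0.
have [q qf qB] := fB _ d0.
have qe : norm_le (opoly q A) (e + d).
  apply: opoly_norm_le => //; first by rewrite addr_ge0// ltW.
  move=> t tA; rewrite -[q.[t]](subrK (f t)) addrC (le_trans (ler_normD _ _))//.
  by rewrite lerD ?fe ?qf.
have -> : B = opoly q A - (opoly q A - B) by rewrite opprB addrC subrK.
by have := norm_leB qe qB x; lra.
Qed.

Lemma cfc_uniq f A B C : selfadj A -> is_cfc f A B -> is_cfc f A C -> B = C.
Proof.
move=> sA fB fC; apply: (@norm_le_eps_eq _ _ _ _ 1) => e e0; rewrite mulr1.
apply: cfc_norm_le (cfc_sub fB fC) _ => //; first exact: ltW.
by move=> t _; rewrite subrr normr0 ltW.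
Qed.

Lemma cfc_selfadj f A B : selfadj A -> is_cfc f A B -> selfadj B.
Proof.
move=> sA /is_cfcP fB x y; apply/eqP; rewrite -subr_eq0 -normr_le0.
apply: (@ler_addgt0_mul _ _ _ (2 * (hnorm x * hnorm y))) => d d0.
have [q _ qB] := fB _ d0.
have -> : rinner (B x) y - rinner x (B y) =
    rinner x ((opoly q A - B) y) - rinner ((opoly q A - B) x) y.
  by rewrite !bopE !rinnerE (selfadj_opoly q sA x y); ring.
rewrite (le_trans (ler_normB _ _))//.
rewrite (le_trans (lerD (rinner_abs _ _) (rinner_abs _ _)))//.
have hx := ler_wpM2r (hnorm_ge0 y) (qB x).
have hy := ler_wpM2l (hnorm_ge0 x) (qB y).
lra.
Qed.

Lemma cfc_ge0 f A B : selfadj A -> is_cfc f A B ->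
  (forall t, spectrum A t%:C -> 0 <= f t) -> forall x, 0 <= rinner (B x) x.
Proof.
move=> sA /is_cfcP fB f0 x; apply: (@ler_addgt0_mul _ _ _ (2 * rinner x x)) => d d0.
have [q qf qB] := fB _ d0.
have q0 : forall x, 0 <= rinner (opoly (q + d%:P) A x) x.
  apply: opoly_ge0 => // t tA; rewrite !hornerE.
  by have := qf t tA; have := f0 t tA; rewrite ler_norml; lra.
have := q0 x; have /andP[_] := selfadj_itv qB x.
by rewrite opolyD opolyC !bopE !rinnerE; lra.
Qed.

Lemma cfc_le f g A B C : selfadj A -> is_cfc f A B -> is_cfc g A C ->
  (forall t, spectrum A t%:C -> f t <= g t) ->
  forall x, rinner (B x) x <= rinner (C x) x.
Proof.
move=> sA fB gC fg x; rewrite -subr_ge0.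
have := cfc_ge0 sA (cfc_sub gC fB) _ x; rewrite !bopE !rinnerE; apply.
by move=> t tA; rewrite subr_ge0 fg.
Qed.

Lemma cfc_bounded f A B : selfadj A -> is_cfc f A B ->
  exists2 c, 0 <= c & forall t, spectrum A t%:C -> `|f t| <= c.
Proof.
move=> sA /is_cfcP/(_ 1 ltr01)[q qf _].
have [c c0 qc] := spectrum_poly_bounded q sA.
exists (c + 1) => [|t tA]; first by rewrite addr_ge0.
rewrite -[f t](subKr q.[t]) (le_trans (ler_normB _ _))// lerD//.
  exact: qc.
exact: qf.
Qed.

Lemma cfc_mul f g A B C : selfadj A -> is_cfc f A B -> is_cfc g A C ->
  is_cfc (fun t => f t * g t) A (B * C).
Proof.
move=> sA fB gC.
have [cf cf0 fcf] := cfc_bounded sA fB.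
have [cg cg0 gcg] := cfc_bounded sA gC.
have Bcf := cfc_norm_le sA cf0 fB fcf.
have Ccg := cfc_norm_le sA cg0 gC gcg.
apply/is_cfcP => e e0.
have K0 : 0 < cf + cg + 1 by rewrite ltr_wpDl// addr_ge0.
(* This d gives (cf + d) d + d cg <= e, the error of a product of two approximations within d. *)
pose d := Num.min 1 (e / (cf + cg + 1)).
have d0 : 0 < d by rewrite lt_min ltr01 divr_gt0.
have de : d * (cf + cg + 1) <= e.
  by rewrite -ler_pdivlMr// ge_min lexx orbT.
have d1 : d <= 1 by rewrite ge_min lexx.
have bound : (cf + d) * d + d * cg <= e.
  apply: le_trans de; rewrite mulrC -mulrDr ler_wpM2l ?(ltW d0)//.
  by rewrite addrAC lerD2l.
have [p pf pB] := (is_cfcP f A B).1 fB _ d0.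
have [q qg qC] := (is_cfcP g A C).1 gC _ d0.
exists (p * q) => [t tA|].
  rewrite hornerM (_ : _ - _ = p.[t] * (q.[t] - g t) + (p.[t] - f t) * g t);
    last by ring.
  rewrite (le_trans (ler_normD _ _))// !normrM (le_trans _ bound)//.
  have pt : `|p.[t]| <= cf + d.
    rewrite -[p.[t]](subrK (f t)) addrC (le_trans (ler_normD _ _))// lerD ?fcf ?pf//.
  by rewrite lerD// ler_pM// ?qg ?pf ?gcg.
rewrite opolyM (_ : _ - _ = opoly p A * (opoly q A - C) + (opoly p A - B) * C).
  apply: (norm_leW bound); apply: norm_leD.
    apply: norm_leM => //; first by rewrite addr_ge0// ltW.
    rewrite -[opoly p A](subrK B) [cf + d]addrC; exact: norm_leD.
  by apply: norm_leM => //; exact: ltW.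
by rewrite mulrBr mulrBl addrA subrK.
Qed.

Lemma cfc_eigen f A B t x : selfadj A -> is_cfc f A B -> x != 0 ->
  A x = t%:C *: x -> B x = (f t)%:C *: x.
Proof.
move=> sA /is_cfcP fB x0 Ax.
have tA : spectrum A t%:C.
  move=> [C [_ CA]]; move: x0; rewrite -[x]bop_oneE -CA !bopE Ax subrr bop0.
  by rewrite eqxx.
apply/eqP; rewrite -subr_eq0; apply/eqP.
apply: (@hnorm_eps_eq0 _ _ _ (hnorm x + hnorm x)) => e e0.
have [q qf qB] := fB _ e0.
have -> : B x - (f t)%:C *: x =
    (q.[t] - f t)%:C *: x - (opoly q A - B) x.
  have -> : (q.[t] - f t)%:C = q.[t]%:C - (f t)%:C by rewrite rmorphB.
  by rewrite !bopE (opoly_eigen q Ax) scalerBl opprB [RHS]addrC addrA subrK.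
rewrite mulrDr (le_trans (hnormD _ _))// lerD//.
  by rewrite hnormZr ler_wpM2r ?hnorm_ge0// qf.
by rewrite hnormN; exact: qB.
Qed.

(** Polynomials within 1 / (2 (n + 1)) of f on [u, v], which contains the spectrum, have values at A
    that are Cauchy in norm by [opoly_norm_le]. *)
Lemma cfc_ex f A u v : selfadj A -> u < v ->
  (forall x, u * rinner x x <= rinner (A x) x <= v * rinner x x) ->
  {in `[u, v], continuous f} -> exists B, is_cfc f A B.
Proof.
move=> sA uv Auv fc.
have spA := spectrum_itv sA Auv.
have e0 (n : nat) : 0 < n.+1%:R^-1 / 2 :> R by rewrite divr_gt0// invr_gt0.
have /choice[q qf] n : exists q : {poly R},
    {in `[u, v], forall t, `|q.[t] - f t| <= n.+1%:R^-1 / 2}.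
  exact: weierstrass.
have [B Bq] : exists B, forall n, norm_le (B - opoly (q n) A) (n.+1%:R^-1).
  apply: bop_complete => [n m nm|d d0].
    rewrite -opolyB; apply: opoly_norm_le => // t /spA tA.
    rewrite !hornerE (_ : _ - _ = ((q m).[t] - f t) - ((q n).[t] - f t));
      last by ring.
    rewrite (le_trans (ler_normB _ _))// [leRHS]splitr.
    apply: lerD; last by rewrite qf ?in_itv.
    rewrite (le_trans (qf m t _)) ?in_itv//.
    by rewrite ler_pM2r ?invr_gt0// lef_pV2 ?posrE// ler_nat.
  exists (Num.truncn d^-1); rewrite invf_ple ?posrE//.
  by rewrite ltW// real_truncnS_gt// num_real.
exists B; apply/is_cfcP => e e_gt0.
have n_e : (Num.truncn e^-1).+1%:R^-1 <= e.
  by rewrite invf_ple ?posrE// ltW// real_truncnS_gt// num_real.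
exists (q (Num.truncn e^-1)) => [t /spA tA|x].
  rewrite (le_trans (qf _ t _)) ?in_itv//.
  by rewrite (le_trans _ n_e)// ler_pdivrMr// ler_peMr ?ler1n// invr_ge0.
rewrite -opprB bopE hnormN; exact: norm_leW n_e (Bq _) x.
Qed.

Lemma cfcP f A : (exists B, is_cfc f A B) -> is_cfc f A (cfc f A).
Proof. by move=> h; rewrite /cfc; case: xgetP => // /(_ _) nB; case: h => B /nB. Qed.

End Calculus.

(** * The Loewner-Heinz inequality *)

Section Powers.
Context {R : realType} {H : hilbertType R}.
Implicit Types (x y z : H) (r c k e t : R) (a : R[i]) (A B C S T X Y Z : 'B(H)).
Implicit Types (p q : R) (f g : R -> R).

Local Notation "a %:B" := (a *: (1 : 'B(H))) (at level 2, format "a %:B").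

Definition form_itv A u v :=
  selfadj A /\ forall x, u * rinner x x <= rinner (A x) x <= v * rinner x x.

Lemma opgt0_itv A : opgt0 A -> exists2 uv : R * R,
  0 < uv.1 < uv.2 & form_itv A uv.1 uv.2.
Proof.
move=> /opgt0P[sA [c c0 Ac]]; have [k k0 Ak] := norm_le_ex A.
exists (c, k + c + 1) => /=; first by rewrite c0/=; lra.
split=> // x; rewrite Ac/=; have /andP[_ h] := selfadj_itv Ak x.
by rewrite (le_trans h)// ler_wpM2r ?rinner_ge0// -addrA lerDl addr_ge0// ltW.
Qed.

Lemma opgt0_spectrum A t : opgt0 A -> spectrum A t%:C -> 0 < t.
Proof.
move=> /opgt0_itv[[u v]/= /andP[u0 _] [sA Auv]] /(spectrum_itv sA Auv)/andP[+ _].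
exact: lt_le_trans.
Qed.

Lemma opgt0_selfadj A : opgt0 A -> selfadj A.
Proof. by case/opgt0P. Qed.

Lemma cfc_gt0P f A : opgt0 A -> {in `]0, +oo[, continuous f} ->
  is_cfc f A (cfc f A).
Proof.
move=> /opgt0_itv[[u v]/= /andP[u0 uv] [sA Auv]] fc; apply: cfcP.
apply: (cfc_ex sA uv Auv) => t; rewrite in_itv/= => /andP[ut _].
by apply: fc; rewrite in_itv/= andbT (lt_le_trans u0).
Qed.

Lemma cfc_ext f g A B : is_cfc f A B ->
  (forall t, spectrum A t%:C -> f t = g t) -> is_cfc g A B.
Proof.
move=> /is_cfcP fB fg; apply/is_cfcP => e /fB[q qf qB].
by exists q => // t tA; rewrite -fg// qf.
Qed.

Lemma powR_continuous p : {in `]0, +oo[, continuous (fun t : R => t `^ p)}.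
Proof.
move=> t t0; apply: differentiable_continuous; apply/derivable1_diffP.
exact: derivable_powR.
Qed.

Lemma oppowP A p : opgt0 A -> is_cfc (fun t => t `^ p) A (oppow A p).
Proof. by move=> A0; apply: cfc_gt0P => //; exact: powR_continuous. Qed.

Lemma oppow_selfadj A p : opgt0 A -> selfadj (oppow A p).
Proof. by move=> A0; apply: cfc_selfadj (oppowP p A0); exact: opgt0_selfadj. Qed.

Lemma oppowD A p q : opgt0 A -> oppow A (p + q) = oppow A p * oppow A q.
Proof.
move=> A0; have sA := opgt0_selfadj A0.
apply: (cfc_uniq sA (oppowP _ A0)).
apply: cfc_ext (cfc_mul sA (oppowP p A0) (oppowP q A0)) _ => t tA.
by rewrite powRD// (gt_eqF (opgt0_spectrum A0 tA)) implybT.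
Qed.

Lemma oppow0 A : opgt0 A -> oppow A 0 = 1.
Proof.
move=> A0; apply: (cfc_uniq (opgt0_selfadj A0) (oppowP _ A0)).
have := cfc_opoly 1%:P A; rewrite opolyC scale1r => /cfc_ext; apply => t _.
by rewrite hornerC powRr0.
Qed.

Lemma oppow1 A : opgt0 A -> oppow A 1 = A.
Proof.
move=> A0; apply: (cfc_uniq (opgt0_selfadj A0) (oppowP _ A0)).
have := cfc_opoly 'X A; rewrite opolyX => /cfc_ext; apply => t tA.
by rewrite hornerX powRr1// ltW// (opgt0_spectrum A0).
Qed.

Lemma oppowNK A p : opgt0 A -> oppow A p * oppow A (- p) = 1.
Proof. by move=> A0; rewrite -oppowD// subrr oppow0. Qed.

Lemma oppowKN A p : opgt0 A -> oppow A (- p) * oppow A p = 1.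
Proof. by move=> A0; rewrite -oppowD// addNr oppow0. Qed.

Lemma expR_lipschitz (L s t : R) : s <= L -> t <= L ->
  `|expR s - expR t| <= expR L * `|s - t|.
Proof.
wlog ts : s t / t <= s => [hw sL tL|sL _].
  by have [/hw|/ltW/hw] := leP t s; [apply|rewrite distrC (distrC s); apply].
rewrite !ger0_norm ?subr_ge0 ?ler_expR//.
apply: (@le_trans _ _ (expR s * (s - t))); last first.
  by rewrite ler_wpM2r ?subr_ge0// ler_expR.
have -> : expR t = expR s * expR (t - s) by rewrite -expRD addrCA subrr addr0.
rewrite -[X in X - _]mulr1 -mulrBr ler_wpM2l ?expR_ge0//.
by have := expR_ge1Dx (t - s); lra.
Qed.

(** On the spectrum t^p = exp(p ln t) with ln t bounded, so t^p is Lipschitz in p uniformly in t.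
    This makes the set of exponents in [loewner_heinz] closed. *)
Lemma oppow_lipschitz A : opgt0 A -> exists2 c : R, 0 <= c & forall p q,
  0 <= p <= 1 -> 0 <= q <= 1 -> norm_le (oppow A p - oppow A q) (c * `|p - q|).
Proof.
move=> A0; have [[u v]/= /andP[u0 uv] [sA Auv]] := opgt0_itv A0.
pose L : R := `|ln u| + `|ln v|.
have L0 : 0 <= L by rewrite addr_ge0.
have lnL t : spectrum A t%:C -> `|ln t| <= L.
  move=> /[dup] /(opgt0_spectrum A0) t0 /(spectrum_itv sA Auv)/andP[ut tv].
  have v0 := lt_trans u0 uv.
  have ltv : ln t <= ln v by rewrite ler_ln ?posrE.
  have lut : ln u <= ln t by rewrite ler_ln ?posrE.
  have := ler_norm (ln v); have := ler_norm (- ln u); rewrite normrN => h1 h2.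
  have h3 := normr_ge0 (ln u); have h4 := normr_ge0 (ln v).
  by rewrite ler_norml /L; lra.
exists (expR L * L) => [|p q /andP[p0 p1] /andP[q0 q1]].
  by rewrite mulr_ge0// expR_ge0.
apply: cfc_norm_le (cfc_sub (oppowP p A0) (oppowP q A0)) _ => //.
  by rewrite !mulr_ge0// expR_ge0.
move=> t tA; have t0 := opgt0_spectrum A0 tA.
have pL (s : R) : 0 <= s -> s <= 1 -> s * ln t <= L.
  move=> s0 s1; rewrite (le_trans (ler_norm _))// normrM ger0_norm//.
  by rewrite -[L]mul1r ler_pM// lnL.
rewrite /powR gt_eqF// (le_trans (expR_lipschitz (pL p p0 p1) (pL q q0 q1)))//.
rewrite -mulrBl normrM -mulrA ler_wpM2l ?expR_ge0// mulrC.
by rewrite ler_wpM2r// lnL.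
Qed.

(** T S is the adjoint of S T, so it has the same norm. *)
Lemma norm_leMC S T : selfadj S -> selfadj T -> norm_le (S * T) 1 ->
  norm_le (T * S) 1.
Proof.
move=> sS sT ST x; rewrite mul1r bopE.
have [h|h0] := eqVneq (hnorm (T (S x))) 0; first by rewrite h hnorm_ge0.
have h : 0 < hnorm (T (S x)) by rewrite lt_neqAle eq_sym h0 hnorm_ge0.
rewrite -(ler_pM2r h) -expr2 sqr_hnorm sT sS.
rewrite (le_trans (rinner_le _ _))// ler_wpM2l ?hnorm_ge0//.
by have := ST (T (S x)); rewrite mul1r bopE.
Qed.

(** |X^(p/2) Y^(-p/2) x|^2 is the form of X^p at Y^(-p/2) x, and the form of Y^p there is |x|^2. *)
Lemma oppow_contraction X Y p : opgt0 X -> opgt0 Y ->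
  (forall x, rinner (oppow X p x) x <= rinner (oppow Y p x) x) ->
  norm_le (oppow X (p / 2) * oppow Y (- (p / 2))) 1.
Proof.
move=> X0 Y0 XY x; rewrite mul1r hnorm_le !bopE.
rewrite -(oppow_selfadj (p / 2) X0) -bop_mulE -oppowD// -splitr.
apply: (le_trans (XY _)).
rewrite {1}[p]splitr oppowD// -!bop_mulE -mulrA oppowNK// mulr1.
by rewrite (oppow_selfadj _ Y0) -bop_mulE oppowNK.
Qed.

(** Similar operators have the same spectrum; that of the contraction W lies in the unit disc by
    [neumann], and the spectrum of the self-adjoint Z bounds its norm. *)
Lemma norm_le_similar (Z W G G' : 'B(H)) : selfadj Z -> norm_le W 1 ->
  G * G' = 1 -> G' * G = 1 -> Z = G' * W * G -> norm_le Z 1.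
Proof.
move=> sZ W1 GG' G'G ZE x.
have [->|x0] := eqVneq x 0; first by rewrite bop0 hnorm0 mulr0.
apply: selfadj_norm_le => //; first by exists x.
move=> r; apply: contra_notP => /negP; rewrite -ltNge => r1.
have r0 : r != 0 by rewrite -normr_gt0 (lt_trans ltr01).
have -> : Z - r%:C%:B = G' * (W - r%:C%:B) * G.
  by rewrite mulrBr mulrBl -ZE bop_scalerAr mulr1 bop_scalerAl G'G.
apply: opunitM; last by exists G'.
apply: opunitM; first by exists G.
apply: opunitN; apply: (@opunitZE _ _ (r^-1)%:C).
  by rewrite fmorph_eq0 invr_eq0.
have -> : (r^-1)%:C *: - (W - r%:C%:B) = 1 - (r^-1)%:C *: W.
  by rewrite opprB scalerBr scalerA -rmorphM mulVf// scale1r.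
apply: (@neumann _ _ _ (`|r^-1| * 1)); last exact: norm_leZ.
by rewrite mulr1 normr_ge0/= normfV invf_lt1// (lt_trans ltr01).
Qed.

Lemma oppow_mid X Y p q : opgt0 X -> opgt0 Y ->
  (forall x, rinner (oppow X p x) x <= rinner (oppow Y p x) x) ->
  (forall x, rinner (oppow X q x) x <= rinner (oppow Y q x) x) ->
  forall x, rinner (oppow X ((p + q) / 2) x) x <= rinner (oppow Y ((p + q) / 2) x) x.
Proof.
move=> X0 Y0 XYp XYq x.
set r := (p + q) / 2.
(* Z is similar to [(Y^(-p/2) X^(p/2)) (X^(q/2) Y^(-q/2))], a product of two   *)
(* contractions.                                                               *)
pose Z := oppow Y (- (r / 2)) * oppow X r * oppow Y (- (r / 2)).
have sZ : selfadj Z by apply: selfadj_conj; exact: oppow_selfadj.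
have W1 : norm_le (oppow Y (- (p / 2)) * oppow X r * oppow Y (- (q / 2))) 1.
  rewrite (_ : r = p / 2 + q / 2) ?oppowD//; last by rewrite /r; field.
  have h1 := norm_leMC (oppow_selfadj _ X0) (oppow_selfadj _ Y0)
    (oppow_contraction X0 Y0 XYp).
  have h2 := oppow_contraction X0 Y0 XYq.
  by have := norm_leM ler01 h1 h2; rewrite mul1r !mulrA.
(* Conjugation by Y^s makes the outer exponents -p/2 and -q/2 both equal to -r/2. *)
pose s := (q - p) / 4.
have Z1 : norm_le Z 1.
  apply: (norm_le_similar sZ W1 (oppowNK s Y0) (oppowKN s Y0)).
  have e1 : oppow Y (- s) * oppow Y (- (p / 2)) = oppow Y (- (r / 2)).
    by rewrite -oppowD//; congr oppow; rewrite /s /r; field.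
  have e2 : oppow Y (- (q / 2)) * oppow Y s = oppow Y (- (r / 2)).
    by rewrite -oppowD//; congr oppow; rewrite /s /r; field.
  by rewrite !mulrA e1 -[RHS]mulrA e2.
have -> : x = oppow Y (- (r / 2)) (oppow Y (r / 2) x).
  by rewrite -bop_mulE oppowKN.
set w := oppow Y (r / 2) x.
have sY := oppow_selfadj (- (r / 2)) Y0.
have YE : oppow Y (- (r / 2)) * (oppow Y r * oppow Y (- (r / 2))) = 1.
  by rewrite [in oppow Y r](splitr r) oppowD// -mulrA oppowNK// mulr1 oppowKN.
rewrite -(sY _ w) -(sY _ w).
have -> : oppow Y (- (r / 2)) (oppow Y r (oppow Y (- (r / 2)) w)) = w.
  exact: (congr1 (fun T : 'B(H) => T w) YE).
by have /andP[_] := selfadj_itv Z1 w; rewrite mul1r.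
Qed.

(** Bisection from 0 and 1 keeps p between two exponents at which the inequality holds; [oppow_mid]
    supplies the midpoint. *)
Lemma oppow_bisect X Y p (n : nat) : opgt0 X -> opgt0 Y ->
  (forall x, rinner (X x) x <= rinner (Y x) x) -> 0 <= p <= 1 ->
  exists2 q, 0 <= q <= 1 /\ `|p - q| <= 2^-1 ^+ n &
    forall x, rinner (oppow X q x) x <= rinner (oppow Y q x) x.
Proof.
move=> X0 Y0 XY /andP[p0 p1].
pose E q := forall x, rinner (oppow X q x) x <= rinner (oppow Y q x) x.
suff [a [b [[a0 ap pb b1] ba Ea Eb]]] : exists a b : R,
    [/\ [/\ 0 <= a, a <= p, p <= b & b <= 1], b - a <= 2^-1 ^+ n, E a & E b].
  exists a => //; split; first by rewrite a0 (le_trans ap).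
  by rewrite ger0_norm ?subr_ge0// (le_trans _ ba)// lerB.
elim: n => [|n [a [b [[a0 ap pb b1] ba Ea Eb]]]].
  exists 0, 1; split; first by split.
  - by rewrite subr0.
  - by move=> x; rewrite !oppow0.
  - by move=> x; rewrite !oppow1.
have Ec : E ((a + b) / 2) by apply: oppow_mid.
have [pc|cp] := leP p ((a + b) / 2).
  exists a, ((a + b) / 2); split => //; last by rewrite exprS; lra.
  by split => //; lra.
exists ((a + b) / 2), b; split => //; last by rewrite exprS; lra.
by split => //; lra.
Qed.

(* Pedersen: the set of exponents p with [X^p <= Y^p] is closed, contains 0    *)
(* and 1, and is stable under midpoints.                                       *)
Theorem loewner_heinz X Y p : opgt0 X -> opgt0 Y ->
  (forall x, rinner (X x) x <= rinner (Y x) x) -> 0 <= p <= 1 ->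
  forall x, rinner (oppow X p x) x <= rinner (oppow Y p x) x.
Proof.
move=> X0 Y0 XY p01 x.
have [cX cX0 hX] := oppow_lipschitz X0; have [cY cY0 hY] := oppow_lipschitz Y0.
apply: (@ler_addgt0_mul _ _ _ ((cX + cY) * rinner x x)) => d d0.
have [n nd] : exists n, 2^-1 ^+ n <= d.
  have h1 : `|2^-1 : R| < 1 by rewrite ger0_norm// invf_lt1// ltr1n.
  have /cvgrPdist_le/(_ d d0)[N _ /(_ N (leqnn _))] /= := cvg_expr h1.
  by rewrite sub0r normrN ger0_norm// => ?; exists N.
have [q [q01 pq] Eq] := oppow_bisect n X0 Y0 XY p01.
have {nd}pq : `|p - q| <= d := le_trans pq nd.
have := Eq x.
have /andP[_] := selfadj_itv (hX p q p01 q01) x.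
have /andP[+ _] := selfadj_itv (hY p q p01 q01) x.
rewrite !bopE !rinnerE.
have := ler_wpM2r (rinner_ge0 x) (ler_wpM2l cX0 pq).
have := ler_wpM2r (rinner_ge0 x) (ler_wpM2l cY0 pq).
lra.
Qed.

End Powers.

(** * The Hilbert space of dimension 2 *)

Section ComplexPlane.
Context (R : realType).

(** A separate type, so that the Euclidean norm can be attached in place of the maximum norm of the
    product. *)
Definition C2 : Type := (R[i]^o * R[i]^o)%type.

HB.instance Definition _ := GRing.Lmodule.copy C2 (R[i]^o * R[i]^o)%type.

Implicit Types (x y z : C2) (a : R[i]).

Definition C2_sqr x : R := complex.Re x.1 ^+ 2 + complex.Im x.1 ^+ 2 +
  complex.Re x.2 ^+ 2 + complex.Im x.2 ^+ 2.

Definition C2_norm x : R[i] := (Num.sqrt (C2_sqr x))%:C.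

Lemma C2_sqr_ge0 x : 0 <= C2_sqr x.
Proof. by rewrite !addr_ge0 ?sqr_ge0. Qed.

Lemma C2_normD x y : C2_norm (x + y) <= C2_norm x + C2_norm y.
Proof.
rewrite /C2_norm -rmorphD lecR.
rewrite -ler_sqr ?nnegrE ?addr_ge0 ?sqrtr_ge0// sqrrD !sqr_sqrtr ?C2_sqr_ge0//.
rewrite -sqrtrM ?C2_sqr_ge0//.
case: x y => [[a1 a2] [a3 a4]] [[b1 b2] [b3 b4]]; rewrite /C2_sqr /=.
set s := Num.sqrt _; have s0 : 0 <= s by exact: sqrtr_ge0.
suff : a1 * b1 + a2 * b2 + a3 * b3 + a4 * b4 <= s by rewrite mulr2n; lra.
rewrite (le_trans (ler_norm _))// -sqrtr_sqr ler_wsqrtr//.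
(* Lagrange's identity: the gap in Cauchy-Schwarz is the sum of the squares of the six 2 by 2
   minors. *)
have h (u v : R) : 0 <= (u - v) ^+ 2 by exact: sqr_ge0.
have := h (a1 * b2) (a2 * b1); have := h (a1 * b3) (a3 * b1).
have := h (a1 * b4) (a4 * b1); have := h (a2 * b3) (a3 * b2).
have := h (a2 * b4) (a4 * b2); have := h (a3 * b4) (a4 * b3).
lra.
Qed.

Lemma C2_normZ a x : C2_norm (a *: x) = `|a| * C2_norm x.
Proof.
rewrite normc_def /C2_norm -rmorphM -sqrtrM ?addr_ge0 ?sqr_ge0//.
congr (Num.sqrt _)%:C; case: x a => [[x1 x2] [x3 x4]] [u v].
by rewrite /C2_sqr /=; ring.
Qed.

Lemma C2_norm_eq0 x : C2_norm x = 0 -> x = 0.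
Proof.
move=> /complexI/eqP; rewrite sqrtr_eq0 => h.
have {h} : C2_sqr x == 0 by rewrite eq_le h C2_sqr_ge0.
case: x => [[a b] [c d]]; rewrite /C2_sqr/=.
rewrite !paddr_eq0 ?addr_ge0 ?sqr_ge0// !sqrf_eq0.
by move=> /andP[/andP[/andP[/eqP-> /eqP->] /eqP->] /eqP->].
Qed.

HB.instance Definition _ := Lmodule_isNormed.Build R[i] C2
  C2_normD C2_normZ C2_norm_eq0.

Definition C2_inner x y : R[i] := x.1 * conjc y.1 + x.2 * conjc y.2.

Lemma C2_inner_sqr x : C2_inner x x = (C2_sqr x)%:C.
Proof.
case: x => [[a b] [c d]]; rewrite /C2_inner /C2_sqr.
by apply/eqP; rewrite eq_complex /=; apply/andP; split; apply/eqP; ring.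
Qed.

Let C2_innerBl y : zmod_morphism (C2_inner ^~ y).
Proof. by move=> u v; rewrite /C2_inner !mulrBl opprD addrACA. Qed.

Let C2_innerBr x : zmod_morphism (C2_inner x).
Proof. by move=> u v; rewrite /C2_inner !rmorphB !mulrBr opprD addrACA. Qed.

Let C2_innerZl y : scalable_for *%R (C2_inner ^~ y).
Proof. by move=> a x; rewrite /C2_inner mulrDr !mulrA. Qed.

Let C2_innerZr x : scalable_for (@Num.conj R[i] \; *%R) (C2_inner x).
Proof.
by move=> a y; rewrite /C2_inner /= !rmorphM mulrDr !(mulrCA (conjc a)).
Qed.

HB.instance Definition _ := isBilinear.Build R[i] C2 C2 R[i] *%R
  (@Num.conj R[i] \; *%R) C2_inner C2_innerBl C2_innerBr C2_innerZl C2_innerZr.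

Let C2_innerC x y : C2_inner x y = (-1) ^+ false * Num.conj (C2_inner y x).
Proof.
rewrite expr0 mul1r -[RHS]/(conjc (C2_inner y x)) /C2_inner rmorphD !rmorphM.
by rewrite /= !conjcK !(mulrC (conjc _)).
Qed.

HB.instance Definition _ :=
  isHermitianSesquilinear.Build R[i] C2 false (@Num.conj R[i]) C2_inner C2_innerC.

Let C2_inner_gt0 x : x != 0 -> 0 < C2_inner x x.
Proof.
move=> x0; rewrite C2_inner_sqr ltcR lt_neqAle C2_sqr_ge0 andbT eq_sym.
apply: contra x0 => /eqP x0; apply/eqP/C2_norm_eq0.
by rewrite /C2_norm x0 sqrtr0.
Qed.

HB.instance Definition _ := isDotProduct.Build R[i] C2 C2_inner C2_inner_gt0.

Lemma C2_normE x : `|x| = C2_norm x.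
Proof. by []. Qed.

(** A 1-Lipschitz coordinate maps a Cauchy filter to a Cauchy filter of R; completeness of [C2] is
    reduced to its four real coordinates. *)
Lemma cauchy_coord (c : C2 -> R) :
  (forall x y, (`|c x - c y|)%:C <= `|x - y|) ->
  forall F : set_system C2, ProperFilter F -> cauchy F ->
  exists l, forall e : R, 0 < e -> \forall x \near F, `|l - c x| < e.
Proof.
move=> cL F PF /cauchy_ballP cF.
have /cauchy_cvg/cvg_ex[l cl] : cauchy (c @ F).
  apply/cauchy_ballP => e e0.
  have := cF e%:C; rewrite ltcR => /(_ e0) [[P Q] /= [FP FQ] PQ].
  exists (c @` P, c @` Q) => /=.
    split; [apply: filterS FP | apply: filterS FQ] => x Px; by exists x.
  move=> [_ _] /= [[x Px <-] [y Qy <-]].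
  have := PQ (x, y) (conj Px Qy); rewrite -!ball_normE /= -ltcR => xy.
  exact: le_lt_trans (cL x y) xy.
by exists l => e e0; have /cvgrPdist_lt/(_ e e0) := cl.
Qed.

Let C2_complete (F : set_system C2) : ProperFilter F -> cauchy F -> cvg F.
Proof.
move=> PF cF.
have sq4 (a b c d : R) : let s := Num.sqrt (a ^+ 2 + b ^+ 2 + c ^+ 2 + d ^+ 2) in
    [/\ `|a| <= s, `|b| <= s, `|c| <= s & `|d| <= s].
  have := sqr_ge0 a; have := sqr_ge0 b; have := sqr_ge0 c; have := sqr_ge0 d.
  by move=> d0 c0 b0 a0 s; split; rewrite -sqrtr_sqr ler_wsqrtr//; lra.
have /cauchy_coord/(_ F PF cF)[a1 a1P] : forall x y : C2,
    (`|complex.Re x.1 - complex.Re y.1|)%:C <= `|x - y|.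
  move=> [[x1 x2] [x3 x4]] [[y1 y2] [y3 y4]]; rewrite C2_normE lecR.
  by case: (sq4 (x1 - y1) (x2 - y2) (x3 - y3) (x4 - y4)).
have /cauchy_coord/(_ F PF cF)[a2 a2P] : forall x y : C2,
    (`|complex.Im x.1 - complex.Im y.1|)%:C <= `|x - y|.
  move=> [[x1 x2] [x3 x4]] [[y1 y2] [y3 y4]]; rewrite C2_normE lecR.
  by case: (sq4 (x1 - y1) (x2 - y2) (x3 - y3) (x4 - y4)).
have /cauchy_coord/(_ F PF cF)[a3 a3P] : forall x y : C2,
    (`|complex.Re x.2 - complex.Re y.2|)%:C <= `|x - y|.
  move=> [[x1 x2] [x3 x4]] [[y1 y2] [y3 y4]]; rewrite C2_normE lecR.
  by case: (sq4 (x1 - y1) (x2 - y2) (x3 - y3) (x4 - y4)).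
have /cauchy_coord/(_ F PF cF)[a4 a4P] : forall x y : C2,
    (`|complex.Im x.2 - complex.Im y.2|)%:C <= `|x - y|.
  move=> [[x1 x2] [x3 x4]] [[y1 y2] [y3 y4]]; rewrite C2_normE lecR.
  by case: (sq4 (x1 - y1) (x2 - y2) (x3 - y3) (x4 - y4)).
apply/cvg_ex; exists (a1 +i* a2, a3 +i* a4).
apply/cvgrPdist_le => e e0.
have [r rE] : exists r : R, e = r%:C by apply/complex_realP/gtr0_real.
have r0 : 0 < r by rewrite -ltcR -rE.
have r2 : 0 < r / 2 by rewrite divr_gt0.
near=> x; rewrite C2_normE rE lecR -[leRHS]ger0_norm ?(ltW r0)// -sqrtr_sqr.
rewrite ler_wsqrtr//.
have h1 : `|a1 - complex.Re x.1| < r / 2 by near: x; exact: a1P.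
have h2 : `|a2 - complex.Im x.1| < r / 2 by near: x; exact: a2P.
have h3 : `|a3 - complex.Re x.2| < r / 2 by near: x; exact: a3P.
have h4 : `|a4 - complex.Im x.2| < r / 2 by near: x; exact: a4P.
have sqle (u : R) : `|u| < r / 2 -> u ^+ 2 <= r ^+ 2 / 4.
  move=> /ltW; rewrite -(ler_pXn2r (ltn0Sn 1)) ?nnegrE ?(ltW r2)//.
  by rewrite real_normK ?num_real// expr_div_n -natrX.
case: (x) h1 h2 h3 h4 => [[x1 x2] [x3 x4]] /= /sqle h1 /sqle h2 /sqle h3 /sqle h4.
rewrite /C2_sqr /=; lra.
Unshelve. all: by end_near. Qed.

HB.instance Definition _ := Uniform_isComplete.Build C2 C2_complete.

Let C2_inner_norm x : C2_inner x x = `|x| ^+ 2.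
Proof.
by rewrite C2_inner_sqr C2_normE -rmorphXn /= sqr_sqrtr// C2_sqr_ge0.
Qed.

HB.instance Definition _ := NormedModule_isHilbert.Build R C2 C2_inner_norm.

End ComplexPlane.

(** * Concavity of operator monotone functions *)

Section Concavity.
Context {R : realType}.
Implicit Types (a b c d l s t u v e : R) (f : R -> R) (z : C2 R).

(** At the unit vector w = c u - s v, an eigenvector of Y, the forms of f(X) and f(Y) are the two
    sides. *)
Lemma operator_monotone_eigen (H : hilbertType R) (X Y : 'B(H)) (u v : H)
    a b c s g f : representing_function f -> opgt0 X -> opgt0 Y -> ople X Y ->
  rinner u u = 1 -> rinner v v = 1 -> rinner u v = 0 -> c ^+ 2 + s ^+ 2 = 1 ->
  X u = a%:C *: u -> X v = b%:C *: v ->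
  Y (c%:C *: u - s%:C *: v) = g%:C *: (c%:C *: u - s%:C *: v) ->
  c ^+ 2 * f a + s ^+ 2 * f b <= f g.
Proof.
move=> [_ fc fm _] X0 Y0 XY uu vv uv cs Xu Xv; set w := _ - _ => Yw.
have neq0 (z : H) : rinner z z = 1 -> z != 0.
  by move=> z1; apply: contra_eq_neq z1 => ->; rewrite rinner0r eq_sym oner_eq0.
have ww : rinner w w = 1.
  by rewrite -[RHS]cs /w !rinnerE (rinnerC v u) uu vv uv; ring.
have fXu := cfc_eigen (opgt0_selfadj X0) (cfc_gt0P X0 fc) (neq0 _ uu) Xu.
have fXv := cfc_eigen (opgt0_selfadj X0) (cfc_gt0P X0 fc) (neq0 _ vv) Xv.
have fYw := cfc_eigen (opgt0_selfadj Y0) (cfc_gt0P Y0 fc) (neq0 _ ww) Yw.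
have /opge0P[_ /(_ w)] := fm _ _ _ X0 Y0 XY.
rewrite !bopE rinnerDl rinnerNl subr_ge0 fYw rinnerZl ww mulr1.
apply: le_trans; rewrite /w bopB !bopZ fXu fXv !rinnerE (rinnerC v u) uu vv uv.
by rewrite le_eqVlt; apply/orP; left; apply/eqP; ring.
Qed.

Lemma rinnerC2 z w : @rinner R (C2 R) z w =
  complex.Re z.1 * complex.Re w.1 + complex.Im z.1 * complex.Im w.1 +
  (complex.Re z.2 * complex.Re w.2 + complex.Im z.2 * complex.Im w.2).
Proof.
case: z w => [[x1 x2] [x3 x4]] [[y1 y2] [y3 y4]].
by rewrite /rinner -[inner _ _]/(C2_inner _ _) /C2_inner /= !mulrN !opprK.
Qed.

(** The real symmetric matrix with diagonal a, d and off-diagonal entry b. *)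
Definition symop_fun a b d z : C2 R :=
  (a%:C * z.1 + b%:C * z.2, b%:C * z.1 + d%:C * z.2).

Lemma symop_subproof a b d : symop_fun a b d \in bounded_operator.
Proof.
apply/bounded_operatorP; split=> [l x y|].
  case: x y => [x1 x2] [y1 y2]; have h (r s : R[i]) :
      r * (l * x1 + y1) + s * (l * x2 + y2) =
      l * (r * x1 + s * x2) + (r * y1 + s * y2) by ring.
  by congr pair; exact: h.
pose K := a ^+ 2 + 2 * b ^+ 2 + d ^+ 2.
have K0 : 0 <= K by rewrite /K; have := sqr_ge0 a; have := sqr_ge0 b;
  have := sqr_ge0 d; lra.
exists (Num.sqrt K)%:C => z.
rewrite !C2_normE /C2_norm -rmorphM lecR -sqrtrM// ler_wsqrtr//.
case: z => [[x1 x2] [x3 x4]]; rewrite /C2_sqr/=.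
have h1 (u v : R) : 0 <= (u - v) ^+ 2 by exact: sqr_ge0.
have := h1 (a * x3) (b * x1); have := h1 (a * x4) (b * x2).
have := h1 (b * x3) (d * x1); have := h1 (b * x4) (d * x2).
rewrite /K; lra.
Qed.

Definition symop a b d : 'B(C2 R) := Bop (symop_subproof a b d).

Lemma symop_selfadj a b d : selfadj (symop a b d).
Proof.
move=> [[x1 x2] [x3 x4]] [[y1 y2] [y3 y4]].
by rewrite !rinnerC2 /=; ring.
Qed.

Lemma symop_form a b d z : rinner (symop a b d z) z =
  a * (complex.Re z.1 ^+ 2 + complex.Im z.1 ^+ 2) +
  2 * b * (complex.Re z.1 * complex.Re z.2 + complex.Im z.1 * complex.Im z.2) +
  d * (complex.Re z.2 ^+ 2 + complex.Im z.2 ^+ 2).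
Proof.
by case: z => [[x1 x2] [x3 x4]]; rewrite !rinnerC2 /=; ring.
Qed.

(* Let X have the eigenvalues a and b on an orthonormal basis obtained from    *)
(* (e1, e2) by a rotation of cosine [sqrt l], and let Y be diagonal with first *)
(* entry [<X e1, e1> + e]. If the second entry is large then [X <= Y], and the *)
(* (e1, e1) entries of [f(X) <= f(Y)] are the two sides below.                 *)
Lemma operator_monotone_concave_eps f a b l e : representing_function f ->
  0 < a -> 0 < b -> 0 <= l <= 1 -> 0 < e ->
  l * f a + (1 - l) * f b <= f (l * a + (1 - l) * b + e).
Proof.
move=> hf a0 b0 /andP[l0 l1] e0.
have l1' : 0 <= 1 - l by rewrite subr_ge0.
pose c := Num.sqrt l; pose s := Num.sqrt (1 - l).
have c2 : c ^+ 2 = l by rewrite sqr_sqrtr.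
have s2 : s ^+ 2 = 1 - l by rewrite sqr_sqrtr.
pose k := c * s * (a - b).
pose g := l * a + (1 - l) * b + e.
pose X := symop (l * a + (1 - l) * b) k ((1 - l) * a + l * b).
(* With this second entry Y - X has diagonal e, k^2 / e and off-diagonal entry -k: it is positive
   with determinant zero. *)
pose Y := symop g 0 ((1 - l) * a + l * b + k ^+ 2 / e).
pose mu := Num.min a b.
have mu0 : 0 < mu by rewrite lt_min a0 b0.
have X0 : opgt0 X.
  apply/opgt0P; split; first exact: symop_selfadj.
  exists mu => // -[[x1 x2] [x3 x4]].
  rewrite symop_form rinnerC2 /=.
  have amu : 0 <= a - mu by rewrite subr_ge0 ge_min lexx.
  have bmu : 0 <= b - mu by rewrite subr_ge0 ge_min lexx orbT.
  (* The form of X - mu in the eigenbasis of X, taken on real and imaginary parts separately. *)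
  have sq u v : 0 <= (a - mu) * (c * u + s * v) ^+ 2 + (b - mu) * (c * v - s * u) ^+ 2.
    by rewrite addr_ge0// mulr_ge0// sqr_ge0.
  have sqE u v : (a - mu) * (c * u + s * v) ^+ 2 + (b - mu) * (c * v - s * u) ^+ 2 =
      (l * a + (1 - l) * b - mu) * u ^+ 2 + 2 * k * (u * v) +
      ((1 - l) * a + l * b - mu) * v ^+ 2.
    rewrite /k; transitivity (
      (a - mu) * (c ^+ 2 * u ^+ 2 + 2 * (c * s) * (u * v) + s ^+ 2 * v ^+ 2) +
      (b - mu) * (c ^+ 2 * v ^+ 2 - 2 * (c * s) * (u * v) + s ^+ 2 * u ^+ 2));
      first by ring.
    by rewrite c2 s2; ring.
  have := sq x1 x3; have := sq x2 x4; rewrite !sqE; lra.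
have XY z : rinner (X z) z <= rinner (Y z) z.
  case: z => [[x1 x2] [x3 x4]]; rewrite !symop_form /= /g.
  have sq u v : 0 <= e * u ^+ 2 - 2 * k * (u * v) + k ^+ 2 / e * v ^+ 2.
    rewrite [leRHS](_ : _ = (e * u - k * v) ^+ 2 / e).
      by rewrite divr_ge0 ?sqr_ge0// ltW.
    by field; rewrite gt_eqF.
  have := sq x1 x3; have := sq x2 x4; lra.
have Y0 : opgt0 Y.
  have /opgt0P[_ [r r0 Xr]] := X0.
  apply/opgt0P; split; first exact: symop_selfadj.
  by exists r => // z; exact: le_trans (Xr z) (XY z).
have sXY : selfadj (Y - X) by apply: selfadjB; exact: symop_selfadj.
have {}XY : ople X Y.
  by apply/opge0P; split=> // z; rewrite !bopE !rinnerE subr_ge0 XY.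
pose e1 : C2 R := (1, 0).
pose u1 : C2 R := (c%:C, s%:C); pose u2 : C2 R := ((- s)%:C, c%:C).
have cs : c ^+ 2 + s ^+ 2 = 1 by rewrite c2 s2 addrC subrK.
have u1u1 : rinner u1 u1 = 1 by rewrite -[RHS]cs rinnerC2 /=; ring.
have u2u2 : rinner u2 u2 = 1 by rewrite -[RHS]cs rinnerC2 /=; ring.
have u1u2 : rinner u1 u2 = 0 by rewrite rinnerC2 /=; ring.
have Xu1 : X u1 = a%:C *: u1.
  congr pair; apply/eqP; rewrite eq_complex /=; apply/andP; split; apply/eqP;
    rewrite /k.
  - rewrite !mul0r !subr0.
    transitivity (c * (l * a + (1 - l) * b + s ^+ 2 * (a - b))); first by ring.
    by rewrite s2; ring.
  - by ring.
  - rewrite !mul0r !subr0.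
    transitivity (s * (c ^+ 2 * (a - b) + (1 - l) * a + l * b)); first by ring.
    by rewrite c2; ring.
  - by ring.
have Xu2 : X u2 = b%:C *: u2.
  congr pair; apply/eqP; rewrite eq_complex /=; apply/andP; split; apply/eqP;
    rewrite /k.
  - rewrite !mul0r !subr0.
    transitivity (s * (- (l * a + (1 - l) * b) + c ^+ 2 * (a - b))); first by ring.
    by rewrite c2; ring.
  - by ring.
  - rewrite !mul0r !subr0.
    transitivity (c * (- s ^+ 2 * (a - b) + (1 - l) * a + l * b)); first by ring.
    by rewrite s2; ring.
  - by ring.
have Ye1 : Y e1 = g%:C *: e1.
  by congr pair; apply/eqP; rewrite eq_complex /=; apply/andP; split; apply/eqP; ring.
have e1E : e1 = c%:C *: u1 - s%:C *: u2.
  congr pair; apply/eqP; rewrite eq_complex /=; apply/andP; split; apply/eqP;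
    rewrite -?cs; ring.
have := operator_monotone_eigen hf X0 Y0 XY u1u1 u2u2 u1u2 cs Xu1 Xu2.
by rewrite -e1E c2 s2; apply.
Qed.

(** Let e tend to 0 in [operator_monotone_concave_eps], by continuity of f at the convex
    combination. *)
Lemma operator_monotone_concave f a b l : representing_function f ->
  0 < a -> 0 < b -> 0 <= l <= 1 ->
  l * f a + (1 - l) * f b <= f (l * a + (1 - l) * b).
Proof.
move=> hf a0 b0 l01.
set F := l * f a + _; set t := l * a + _.
have t0 : 0 < t.
  have /andP[l0 l1] := l01; rewrite /t.
  have [ab|/ltW ba] := leP a b.
    have := mulr_ge0 (_ : 0 <= 1 - l) (_ : 0 <= b - a); rewrite !subr_ge0.
    by move=> /(_ l1 ab); lra.
  have := mulr_ge0 l0 (_ : 0 <= a - b); rewrite subr_ge0 => /(_ ba); lra.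
rewrite leNgt; apply/negP => tF.
have [_ fc _ _] := hf.
have ct : {for t, continuous f} by apply: fc; rewrite in_itv/= andbT.
have d0 : 0 < F - f t by rewrite subr_gt0.
have /cvgrPdist_lt/(_ _ d0) [d /= dd fd] := ct.
have e0 : 0 < d / 2 by rewrite divr_gt0.
have : `|f t - f (t + d / 2)| < F - f t.
  apply: fd => /=; rewrite opprD addrA subrr sub0r normrN ger0_norm ?(ltW e0)//.
  by rewrite ltr_pdivrMr// mulr_natr mulr2n ltrDl.
rewrite distrC; apply/negP; rewrite -leNgt.
have := operator_monotone_concave_eps hf a0 b0 l01 e0; rewrite -/F -/t => Ff.
by rewrite (le_trans _ (ler_norm _))// lerB.
Qed.

Lemma chord_le f m M t : representing_function f -> 0 < m -> m < M ->
  m <= t <= M -> chord_const f m M + chord_slope f m M * t <= f t.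
Proof.
move=> hf m0 mM /andP[mt tM].
have Mm : 0 < M - m by rewrite subr_gt0.
have l01 : 0 <= (M - t) / (M - m) <= 1.
  by rewrite divr_ge0 ?subr_ge0 ?(ltW mM)//= ler_pdivrMr// mul1r lerB.
have := operator_monotone_concave hf m0 (lt_trans m0 mM) l01.
rewrite /chord_const /chord_slope.
have -> : (M - t) / (M - m) * m + (1 - (M - t) / (M - m)) * M = t.
  by field; rewrite gt_eqF.
congr (_ <= _); by field; rewrite gt_eqF.
Qed.

(** s is the supremum of the slopes of chords from 1 to the right. By concavity each slope from the
    left is an upper bound of these, so the line of slope s through (1, 1) lies above f on both
    sides. *)
Lemma supergradient f : representing_function f ->
  exists s, forall t, 0 < t -> f t <= 1 - s + s * t.
Proof.
move=> hf; have [_ _ _ f1] := hf.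
have slope u t : 0 < u -> u < 1 -> 1 < t -> (f t - 1) * (1 - u) <= (1 - f u) * (t - 1).
  move=> u0 u1 t1; have tu : 0 < t - u by lra.
  have l01 : 0 <= (t - 1) / (t - u) <= 1.
    rewrite divr_ge0 ?(ltW tu) ?subr_ge0 ?(ltW t1)//= ler_pdivrMr//; lra.
  have := operator_monotone_concave hf u0 (lt_trans ltr01 t1) l01.
  have -> : (t - 1) / (t - u) * u + (1 - (t - 1) / (t - u)) * t = 1.
    by field; rewrite gt_eqF.
  have -> : (t - 1) / (t - u) * f u + (1 - (t - 1) / (t - u)) * f t =
      ((t - 1) * f u + (1 - u) * f t) / (t - u).
    by field; rewrite gt_eqF.
  by rewrite f1 ler_pdivrMr//; lra.
pose E : set R := [set (f t - 1) / (t - 1) | t in [set t | 1 < t]].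
have E0 : E !=set0 by exists ((f 2 - 1) / (2 - 1)), 2 => //=; rewrite ltr1n.
have Eub u : 0 < u -> u < 1 -> ubound E ((1 - f u) / (1 - u)).
  move=> u0 u1 _ [t /= t1 <-]; rewrite ler_pdivrMr ?subr_gt0//.
  by rewrite mulrAC ler_pdivlMr ?subr_gt0// slope.
exists (sup E) => t t0; have [t1|t1|->] := ltgtP t 1; last by rewrite f1; lra.
- have := ge_sup E0 (Eub t t0 t1); rewrite ler_pdivlMr ?subr_gt0//; lra.
- have : (f t - 1) / (t - 1) <= sup E.
    apply: ub_le_sup; last by exists t.
    by exists ((1 - f 2^-1) / (1 - 2^-1)); apply: Eub;
      rewrite ?invr_gt0// invf_lt1// ltr1n.
  by rewrite ler_pdivrMr ?subr_gt0//; lra.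
Qed.

End Concavity.

(** * Operator means and affine functions *)

Section Means.
Context {R : realType} {H : hilbertType R}.
Implicit Types (x : H) (A B : 'B(H)) (f : R -> R).

Local Notation "a %:B" := (a *: (1 : 'B(H))) (at level 2, format "a %:B").

Lemma opge0_ople A B : ople A B <->
  selfadj (B - A) /\ forall x, rinner (A x) x <= rinner (B x) x.
Proof.
rewrite /ople opge0P; split=> -[sBA h]; split=> // x.
  by have := h x; rewrite !bopE !rinnerE subr_ge0.
by rewrite !bopE !rinnerE subr_ge0.
Qed.

Lemma opgt0Z (r : R) A : 0 < r -> opgt0 (r%:C *: A) -> opgt0 A.
Proof.
move=> r0 /opgt0P[srA [c c0 rAc]]; apply/opgt0P; split.
  move=> x y; apply: (mulfI (lt0r_neq0 r0)).
  by rewrite -rinnerZl -rinnerZr; exact: srA.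
exists (c / r) => [|x]; first exact: divr_gt0.
by rewrite mulrAC ler_pdivrMr// [leRHS]mulrC -(rinnerZl r); exact: rAc.
Qed.

Lemma ople_selfadj A B : selfadj A -> ople A B -> selfadj B.
Proof.
by move=> sA /opge0_ople[sBA _]; rewrite -(subrK A B); exact: selfadjD.
Qed.

Lemma affine_cfc A (k l : R) : is_cfc (fun t => k + l * t) A (k%:C%:B + l%:C *: A).
Proof.
have := cfc_opoly (k%:P + l%:P * 'X) A.
rewrite opolyD opolyM !opolyC opolyX bop_scalerAl mul1r => /cfc_ext; apply => t _.
by rewrite !hornerE.
Qed.

(** C = A^(-1/2) B A^(-1/2) has its spectrum in [m, M], so the affine bounds hold for f(C);
    conjugation by A^(1/2) turns k + l C into k A + l B. *)
Lemma opmean_le f A B (m M k0 k1 l0 l1 : R) :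
  {in `]0, +oo[, continuous f} -> opgt0 A -> 0 < m ->
  ople (m%:C *: A) B -> ople B (M%:C *: A) ->
  (forall t, m <= t <= M -> k0 + k1 * t <= f t <= l0 + l1 * t) ->
  selfadj (opmean f A B) /\ forall x,
    k0 * rinner (A x) x + k1 * rinner (B x) x <= rinner (opmean f A B x) x <=
    l0 * rinner (A x) x + l1 * rinner (B x) x.
Proof.
move=> fc A0 m0 mAB BMA fkl.
have sA := opgt0_selfadj A0.
have sB := ople_selfadj (selfadjZ m sA) mAB.
rewrite /opmean; set S := oppow A _; set T := oppow A _.
have sS : selfadj S by exact: oppow_selfadj.
have sT : selfadj T by exact: oppow_selfadj.
have ST : S * T = 1 by exact: oppowNK.
have TS : T * S = 1 by exact: oppowKN.
have SS : S * S = A.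
  by rewrite -oppowD// -[RHS](oppow1 A0); congr oppow; field.
set C := T * B * T.
have sC : selfadj C by exact: selfadj_conj.
have SCS : S * C * S = B by rewrite /C !mulrA ST mul1r -mulrA TS mulr1.
have TAT : T * A * T = 1 by rewrite -SS !mulrA TS mul1r ST.
have Cform x : rinner (C x) x = rinner (B (T x)) (T x) by rewrite -sT.
have Tform x : rinner (A (T x)) (T x) = rinner x x.
  by rewrite -sT; congr rinner; exact: (congr1 (fun D : 'B(H) => D x) TAT).
have CmM x : m * rinner x x <= rinner (C x) x <= M * rinner x x.
  rewrite Cform -Tform; have /opge0_ople[_ /(_ (T x))] := mAB.
  have /opge0_ople[_ /(_ (T x))] := BMA.
  by rewrite !bopE !rinnerE => -> ->.
have C0 : opgt0 C.
  by apply/opgt0P; split=> //; exists m => // x; have /andP[] := CmM x.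
have fC := cfc_gt0P C0 fc.
have Cmt := spectrum_itv sC CmM.
split; first by apply: selfadj_conj => //; exact: cfc_selfadj fC.
move=> x.
have Sform D : rinner ((S * D * S) x) x = rinner (D (S x)) (S x) by rewrite -sS.
have aform k l : k * rinner (A x) x + l * rinner (B x) x =
    rinner ((k%:C%:B + l%:C *: C) (S x)) (S x).
  rewrite bop_addE !bop_scaleE bop_oneE !rinnerE -Sform SCS.
  by rewrite -sS -bop_mulE SS.
rewrite Sform !aform; apply/andP; split.
  by apply: (cfc_le sC (affine_cfc C k0 k1) fC) => t /Cmt/fkl/andP[].
by apply: (cfc_le sC fC (affine_cfc C l0 l1)) => t /Cmt/fkl/andP[].
Qed.

End Means.

(** * Summation of the affine bounds and comparison of powers *)

Theorem proposition2p5 (R : realType) (H : hilbertType R) (m M : R)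
    (n : nat) (A B : 'I_n -> 'B(H)) (f : R -> R) (p : R)
    (hm : 0 < m) (hm1 : m < 1) (hM : 1 < M)
    (hAB : forall j : 'I_n,
      opgt0 (m%:C *: A j) /\
      ople (m%:C *: A j) (B j) /\
      ople (B j) (M%:C *: A j))
    (hAB0 :
      opgt0 (m%:C *: (1 - \sum_j A j)) /\
      ople (m%:C *: (1 - \sum_j A j)) (1 - \sum_j B j) /\
      ople (1 - \sum_j B j) (M%:C *: (1 - \sum_j A j)))
    (hf : representing_function f)
    (hp : 0 <= p <= 1) :
  ople (oppow (1 - \sum_j opmean f (A j) (B j)) p)
       (oppow ((chord_gap f m M)%:C *: (1 : 'B(H))
               + opmean f (1 - \sum_j A j) (1 - \sum_j B j)) p).
Proof.
have mM : m < M := lt_trans hm1 hM.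
have [fpos fc _ f1] := hf.
have [s sP] := supergradient hf.
pose mu := chord_slope f m M; pose nu := chord_const f m M.
have tpos t : m <= t <= M -> 0 < t by move=> /andP[mt _]; exact: lt_le_trans mt.
have bounds t : m <= t <= M -> nu + mu * t <= f t <= (1 - s) + s * t.
  by move=> tmM; rewrite chord_le//= sP// tpos.
(* The chord is a convex combination of f m and f M, so c is a positive constant minorant of f on
   [m, M]; it gives the complementary mean the lower bound c A_0. *)
pose c := Num.min (f m) (f M).
have c0 : 0 < c by rewrite lt_min !fpos// (lt_trans hm).
have cbounds t : m <= t <= M -> c + 0 * t <= f t <= (1 - s) + s * t.
  move=> tmM; have /andP[nf ->] := bounds t tmM; rewrite andbT mul0r addr0.
  apply: le_trans nf; have /andP[mt tM] := tmM.
  have Mm : 0 < M - m by rewrite subr_gt0.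
  rewrite /nu /mu /chord_const /chord_slope mulrAC -mulrDl ler_pdivlMr//.
  have cm : c <= f m by rewrite ge_min lexx.
  have cM : c <= f M by rewrite ge_min lexx orbT.
  have := ler_wpM2r (_ : 0 <= M - t) cm; have := ler_wpM2r (_ : 0 <= t - m) cM.
  by rewrite !subr_ge0 => /(_ mt) h1 /(_ tM) h2; lra.
(* The left side is the gap at t = 1, which lies in [m, M]. *)
have gap : 1 - mu - nu <= chord_gap f m M.
  have [t _ [-> /(_ 1)]] := chord_gap_max hf hm mM.
  by rewrite f1 mulr1; apply; rewrite in_itv/= !ltW.
have [mA0 [mAB0 BMA0]] := hAB0.
have A0 := opgt0Z hm mA0.
have Aj j : opgt0 (A j) by apply: (opgt0Z hm); have [] := hAB j.
have [sigma0 hsigma0] := opmean_le fc A0 hm mAB0 BMA0 bounds.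
have [_ hc] := opmean_le fc A0 hm mAB0 BMA0 cbounds.
have sigmaj j : selfadj (opmean f (A j) (B j)) /\ forall x,
    nu * rinner (A j x) x + mu * rinner (B j x) x <=
      rinner (opmean f (A j) (B j) x) x <=
    (1 - s) * rinner (A j x) x + s * rinner (B j x) x.
  by have [_ [h1 h2]] := hAB j; exact: opmean_le (Aj j) hm h1 h2 bounds.
set S := \sum_j opmean f (A j) (B j).
have rsum (F : 'I_n -> 'B(H)) x : rinner ((\sum_j F j) x) x = \sum_j rinner (F j x) x.
  rewrite bop_sumE; elim/big_rec2: _ => [|j y z _ <-]; last by rewrite rinnerDl.
  exact: rinner0l.
have Slow x : nu * rinner ((\sum_j A j) x) x + mu * rinner ((\sum_j B j) x) x <=
    rinner (S x) x.
  rewrite !rsum !mulr_sumr -big_split ler_sum// => j _.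
  by have [_ /(_ x)/andP[]] := sigmaj j.
have Sup x : rinner (S x) x <=
    (1 - s) * rinner ((\sum_j A j) x) x + s * rinner ((\sum_j B j) x) x.
  rewrite !rsum !mulr_sumr -big_split ler_sum// => j _.
  by have [_ /(_ x)/andP[]] := sigmaj j.
have sS : selfadj S by apply: selfadj_sum => j; have [] := sigmaj j.
(* With A_0, B_0 the complementary pair, 1 - S >= (1 - s) A_0 + s B_0 >= A_0 sigma_f B_0 >= c A_0 >=
   c d. *)
have X0 : opgt0 (1 - S).
  apply/opgt0P; split; first by apply: selfadjB => //; exact: selfadj1.
  have /opgt0P[_ [d d0 dA]] := A0; exists (c * d); first exact: mulr_gt0.
  move=> x; have /andP[h1 h2] := hc x.
  have := ler_wpM2l (ltW c0) (dA x); have := Sup x.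
  move: h1 h2; rewrite !bopE !rinnerE; lra.
set Y := _ + opmean f _ _.
(* The lower bounds of S and of the complementary mean add up to the form of (nu + mu) I, and [gap]
   compares this with 1 - beta_f. *)
have XY x : rinner ((1 - S) x) x <= rinner (Y x) x.
  have /andP[h _] := hsigma0 x; have := Slow x.
  have := ler_wpM2r (rinner_ge0 x) gap.
  move: h; rewrite /Y !bopE !rinnerE; lra.
have Y0 : opgt0 Y.
  have /opgt0P[_ [d d0 dX]] := X0; apply/opgt0P; split.
    by apply: selfadjD => //; exact: selfadj_scalar.
  by exists d => // x; exact: le_trans (dX x) (XY x).
apply/opge0_ople; split; last exact: loewner_heinz.
by apply: selfadjB; exact: oppow_selfadj.
Qed.
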